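(* Let $0<p\le 1$ and let $\mathbb{X}$ be a $p$-convex quasi-Banach space with an $M$-bounded semi-normalized basis $\mathcal{B}$. (i) Suppose that $\mathcal{B}$ is super-democratic, that the restricted truncation operator is uniformly bounded, and that $\mathbf{w}$ is a weight whose primitive weight is equivalent to $\varphi_u^{\mathcal{E}}$. Then $$d_{1,p}(\mathbf{w})\stackrel{\mathcal{B}}{\hookrightarrow}\mathbb{X}\stackrel{\mathcal{B}}{\hookrightarrow}d_{1,\infty}(\mathbf{w}),\qquad( * )$$ where $d_{1,p}(\mathbf{w})$ and $d_{1,\infty}(\mathbf{w})$ are quasi-Banach function spaces on $\mathbb{N}$ with equivalent fundamental functions. (ii) Conversely, if $( * )$ holds for some $0<p<\infty$ and some weight $\mathbf{w}$ with primitive weight $\mathbf{s}$, then $\varphi_l^{\mathcal{E}}\approx\mathbf{s}\approx\varphi_u^{\mathcal{E}}$.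
   Context: The scalar field $\mathbb{F}$ is $\mathbb{R}$ or $\mathbb{C}$. A quasi-norm satisfies the axioms of a norm except that the triangle inequality is replaced by $\Vert f+g\Vert\le\kappa(\Vert f\Vert+\Vert g\Vert)$ for some $\kappa\ge1$; a quasi-Banach space is a vector space complete for the topology of a quasi-norm. It is $p$-convex if there is $C$ with $\Vert\sum_{j=1}^nf_j\Vert\le C(\sum_{j=1}^n\Vert f_j\Vert^p)^{1/p}$ for all $n$ and all $f_j\in\mathbb{X}$. For positive sequences, $\alpha\approx\beta$ (equivalent) means each is bounded by a constant times the other. A basis of $\mathbb{X}$ is a sequence $\mathcal{B}=(\mathbf{x}_n)_{n=1}^\infty$ whose closed linear span is $\mathbb{X}$ and for which there is a (unique) sequence $(\mathbf{x}_n^* )_{n=1}^\infty$ in $\mathbb{X}^*$ with $\mathbf{x}_n^*(\mathbf{x}_k)=\delta_{k,n}$. It is $M$-bounded if $\sup_n\Vert\mathbf{x}_n\Vert\,\Vert\mathbf{x}_n^*\Vert<\infty$ and semi-normalized if $0<\inf_n\Vert\mathbf{x}_n\Vert\le\sup_n\Vert\mathbf{x}_n\Vert<\infty$. For finite $A\subseteq\mathbb{N}$ and a family $\varepsilon=(\varepsilon_n)_{n\in A}$ of signs (scalars of modulus one), $\mathbf{1}_{\varepsilon,A}=\sum_{n\in A}\varepsilon_n\mathbf{x}_n$. $\mathcal{B}$ is super-democratic if there is $C$ with $\Vert\mathbf{1}_{\varepsilon,A}\Vert\le C\Vert\mathbf{1}_{\delta,B}\Vert$ for all finite $A,B$ with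 $|A|\le|B|$ and all signs $\varepsilon,\delta$. Put $\varphi_u^{\mathcal{E}}(m)=\sup\{\Vert\mathbf{1}_{\varepsilon,A}\Vert:|A|\le m,\ \varepsilon\text{ signs}\}$ and $\varphi_l^{\mathcal{E}}(m)=\inf\{\Vert\mathbf{1}_{\varepsilon,A}\Vert:|A|\ge m,\ \varepsilon\text{ signs}\}$ ($A$ finite). For $f\in\mathbb{X}$ and $m\ge0$, $A_m(f)$ is the unique $A\subseteq\mathbb{N}$ with $|A|=m$ such that for all $n\in A$, $k\notin A$, either $|\mathbf{x}_n^*(f)|>|\mathbf{x}_k^*(f)|$, or equality holds and $n<k$. The $m$th restricted truncation operator is $\mathcal{U}_m(f)=\min_{n\in A}|\mathbf{x}_n^*(f)|\sum_{n\in A}\mathrm{sign}(\mathbf{x}_n^*(f))\mathbf{x}_n$ with $A=A_m(f)$ ($\mathcal{U}_0=0$), where $\mathrm{sign}(0)=1$ and $\mathrm{sign}(a)=a/|a|$ for $a\neq 0$; it is uniformly bounded if $\sup_m\sup_{\Vert f\Vert\le1}\Vert\mathcal{U}_m(f)\Vert<\infty$. A gauge on $\mathbb{N}$ is a map $\Vert\cdot\Vert_{\mathbb{S}}\colon\mathbb{F}^{\mathbb{N}}\to[0,\infty]$ with $\Vert f\Vert_{\mathbb S}>0$ for $f\ne0$, positively homogeneous ($\Vert tf\Vert_{\mathbb S}=|t|\Vert f\Vert_{\mathbb S}$), monotone ($\Vert(b_n)\Vert_{\mathbb S}\le\Vert(a_n)\Vert_{\mathbb S}$ if $|b_n|\le|a_n|$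 for all $n$), finite on indicators of finite sets, and satisfying $\Vert(\lim_ka_{n,k})_n\Vert_{\mathbb S}=\lim_k\Vert(a_{n,k})_n\Vert_{\mathbb S}$ for $(a_{n,k})$ in $[0,\infty)$ non-decreasing in $k$. Its function space is $\mathbb{S}=\{f:\Vert f\Vert_{\mathbb S}<\infty\}$; it is a quasi-Banach function space if $\Vert\cdot\Vert_{\mathbb S}$ satisfies the quasi-triangle inequality. The fundamental function of a symmetric (i.e., invariant under permutations of the indices) gauge, and of its space, is $m\mapsto\Vert\sum_{n=1}^m\mathbf{e}_n\Vert_{\mathbb{S}}$, where $(\mathbf{e}_n)$ is the unit vector system. A weight is a sequence $\mathbf{w}=(w_n)$ of positive numbers; its primitive weight is $\mathbf{s}=(s_n)$, $s_n=\sum_{j=1}^nw_j$. For $f=(a_n)\in c_0$ with non-increasing rearrangement $(a_n^* )$ of $(|a_n|)$, and $0<q<\infty$, $\Vert f\Vert_{1,q,\mathbf{w}}=\left(\sum_n(a_n^* )^qs_n^{q-1}w_n\right)^{1/q}$ and $\Vert f\Vert_{1,\infty,\mathbf{w}}=\sup_na_n^*s_n$; for general $f\in\mathbb{F}^{\mathbb{N}}$, $\Vert f\Vert_{1,q,\mathbf{w}}$ is the supremum over $m$ of the value at the truncation of $f$ to its first $m$ coordinates. $d_{1,q}(\mathbf{w})$ is the function space of this symmetric gauge. $\mathbb{S}\stackrel{\mathcal{B}}{\hookrightarrow}\mathbb{X}$ means: for every $f=(a_n)\in\mathbb{S}$ the series $\sum_na_n\mathbf{x}_n$ converges in $\mathbb{X}$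 and $\Vert\sum_na_n\mathbf{x}_n\Vert\le C\Vert f\Vert_{\mathbb{S}}$ for a constant $C$. $\mathbb{X}\stackrel{\mathcal{B}}{\hookrightarrow}\mathbb{S}$ means: $\Vert(\mathbf{x}_n^*(f))_n\Vert_{\mathbb{S}}\le C\Vert f\Vert$ for all $f\in\mathbb{X}$ and a constant $C$.
   Formalization: Elements of d_{1,p}(w) are additionally required to be null sequences in the first embedding; literally (i) fails when the primitive weight is bounded (c_0 with its unit vectors, f=(1,1,...)); for unbounded primitive weight a finite gauge already forces f in c_0. *)

(* Defs.v *)
From HB Require Import structures.
From mathcomp Require Import all_boot all_order all_algebra.
From mathcomp Require Import finmap complex.
From mathcomp Require Import all_classical all_reals all_analysis.

Set Implicit Arguments.
Unset Strict Implicit.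
Unset Printing Implicit Defensive.

Import Order.TTheory GRing.Theory Num.Theory.
Import numFieldNormedType.Exports.

Local Open Scope classical_set_scope.
Local Open Scope ring_scope.

(* Conventions.  Bases, sequences and weights are indexed from 0: [xx n] is
   x_(n+1), [w n] is w_(n+1).  Functions of a cardinality ([primitive],
   [phi_u], [phi_l], [fundamental]) take the cardinality m itself. *)

Variant scalar_kind := RealScalars | ComplexScalars.

Definition scalar_field (R : realType) (k : scalar_kind) : numFieldType :=
  match k with
  | RealScalars => R
  | ComplexScalars => R[i]
  end.

Definition modulus (R : realType) (k : scalar_kind) : scalar_field R k -> R :=
  match k with
  | RealScalars => fun x : R => `|x|
  | ComplexScalars => fun x : R[i] => ComplexField.Normc.normc x
  end.

Definition of_real (R : realType) (k : scalar_kind) : R -> scalar_field R k :=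
  match k with
  | RealScalars => fun x : R => x
  | ComplexScalars => fun x : R => real_complex R x
  end.
Arguments of_real {R} k x.

(* The norm of a [numFieldType] lives in the field itself, so this is a / |a|
   computed in F. *)
Definition sign (F : numFieldType) (a : F) : F := if a == 0 then 1 else a / `|a|.

Definition equivalent (R : realType) (alpha beta : nat -> R) : Prop :=
  exists C : R, forall m : nat, (0 < m)%N ->
    alpha m <= C * beta m /\ beta m <= C * alpha m.

Section QuasiBanach.
Variables (R : realType) (k : scalar_kind).
Local Notation F := (scalar_field R k).
Variables (X : lmodType F) (nrm : X -> R).

Definition quasi_norm : Prop :=
  [/\ forall f, 0 <= nrm f,
      forall f, nrm f = 0 -> f = 0,
      forall (t : F) f, nrm (t *: f) = modulus t * nrm f &
      exists kappa : R, 1 <= kappa /\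
        forall f g, nrm (f + g) <= kappa * (nrm f + nrm g)].

Definition converges_to (u : nat -> X) (l : X) : Prop :=
  (fun n => nrm (u n - l)) @ \oo --> (0 : R).

Definition cauchy_sequence (u : nat -> X) : Prop :=
  forall e : R, 0 < e -> exists N : nat, forall m n : nat,
    (N <= m)%N -> (N <= n)%N -> nrm (u m - u n) < e.

(* The topology of a quasi-norm is metrizable (Aoki-Rolewicz), so
   completeness is sequential. *)
Definition quasi_banach : Prop :=
  quasi_norm /\
  forall u, cauchy_sequence u -> exists l, converges_to u l.

Definition p_convex (p : R) : Prop :=
  exists C : R, forall (n : nat) (f : 'I_n -> X),
    nrm (\sum_(j < n) f j) <= C * (\sum_(j < n) nrm (f j) `^ p) `^ p^-1.

(* [X^*] is the space of linear functionals continuous for the quasi-norm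
   topology; a neighbourhood base of f is given by the sets
   {g | nrm (g - f) < d}. *)
Definition continuous_functional (phi : X -> F) : Prop :=
  forall (f : X) (e : R), 0 < e -> exists2 d : R, 0 < d &
    forall g, nrm (g - f) < d -> modulus (phi g - phi f) < e.

Definition dual_norm (phi : X -> F) : R :=
  sup [set modulus (phi f) | f in [set f | nrm f <= 1]].

Variables (xx : nat -> X) (xs : nat -> {scalar X}).

Definition dense_span : Prop :=
  forall (f : X) (e : R), 0 < e -> exists (n : nat) (c : nat -> F),
    nrm (f - \sum_(i < n) c i *: xx i) < e.

Definition is_basis : Prop :=
  [/\ dense_span,
      forall n, continuous_functional (xs n) &
      forall n j, xs n (xx j) = (j == n)%:R].

Definition M_bounded : Prop :=
  exists C : R, forall n, nrm (xx n) * dual_norm (xs n) <= C.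

Definition semi_normalized : Prop :=
  exists c C : R, 0 < c /\ forall n, c <= nrm (xx n) <= C.

Definition signs (A : {fset nat}) (eps : nat -> F) : Prop :=
  forall n, n \in A -> modulus (eps n) = 1.

Definition signed_indicator (eps : nat -> F) (A : {fset nat}) : X :=
  \sum_(n <- A) eps n *: xx n.

Definition super_democratic : Prop :=
  exists C : R, forall (A B : {fset nat}) (eps delta : nat -> F),
    (#|` A| <= #|` B|)%N -> signs A eps -> signs B delta ->
    nrm (signed_indicator eps A) <= C * nrm (signed_indicator delta B).

(* For a semi-normalized basis of a p-convex space, the set below is bounded
   above, so that the real-valued [sup] is the actual supremum. *)
Definition phi_u (m : nat) : R :=
  sup [set r | exists (A : {fset nat}) (eps : nat -> F),
    [/\ (#|` A| <= m)%N, signs A eps & r = nrm (signed_indicator eps A)]].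

Definition phi_l (m : nat) : R :=
  inf [set r | exists (A : {fset nat}) (eps : nat -> F),
    [/\ (m <= #|` A|)%N, signs A eps & r = nrm (signed_indicator eps A)]].

Definition is_greedy_set (f : X) (m : nat) (A : {fset nat}) : Prop :=
  #|` A| = m /\
  forall n j, n \in A -> j \notin A ->
    modulus (xs j f) < modulus (xs n f) \/
    (modulus (xs n f) = modulus (xs j f) /\ (n < j)%N).

(* The greedy set exists and is unique since the coefficients of f with
   respect to an M-bounded semi-normalized basis tend to 0. *)
Definition greedy_set (f : X) (m : nat) : {fset nat} :=
  xget fset0 [set A | is_greedy_set f m A].

(* For m = 0 the sum is empty, hence U_0 = 0. *)
Definition restricted_truncation (m : nat) (f : X) : X :=
  of_real k (inf [set modulus (xs n f) | n in [set` greedy_set f m]]) *: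
    \sum_(n <- greedy_set f m) sign (xs n f) *: xx n.

Definition truncation_bounded : Prop :=
  exists C : R, forall (m : nat) (f : X),
    nrm f <= 1 -> nrm (restricted_truncation m f) <= C.

End QuasiBanach.

Section Gauges.
Variables (R : realType) (k : scalar_kind).
Local Notation F := (scalar_field R k).
Variable N : (nat -> F) -> \bar R.

Definition indicator_seq (A : {fset nat}) : nat -> F := fun n => (n \in A)%:R.

Definition fatou_property : Prop :=
  forall (a : nat -> nat -> R) (b : nat -> R),
    (forall n j, 0 <= a n j) ->
    (forall n, {homo a n : i j / (i <= j)%N >-> i <= j}) ->
    (forall n, a n @ \oo --> b n) ->
    (fun j => N (fun n => of_real k (a n j))) @ \oo -->
      N (fun n => of_real k (b n)).

Definition is_gauge : Prop :=
  [/\ forall f : nat -> F, (0 <= N f)%E,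
      forall f : nat -> F, (exists n, f n != 0) -> (0 < N f)%E,
      forall (t : F) (f : nat -> F),
        N (fun n => t * f n) = ((modulus t)%:E * N f)%E,
      forall f g : nat -> F,
        (forall n, modulus (g n) <= modulus (f n)) -> (N g <= N f)%E &
      (forall A : {fset nat}, (N (indicator_seq A) < +oo)%E) /\
      fatou_property].

Definition symmetric_gauge : Prop :=
  forall (s : nat -> nat) (f : nat -> F), bijective s -> N (f \o s) = N f.

Definition quasi_banach_function_space : Prop :=
  is_gauge /\
  exists kappa : R, 1 <= kappa /\
    forall f g : nat -> F, (N (fun n => f n + g n)%R <= kappa%:E * (N f + N g))%E.

(* [fine] loses nothing: gauges are finite on indicators of finite sets. *)
Definition fundamental (m : nat) : R := fine (N (fun n => (n < m)%N%:R)).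

End Gauges.

Section Lorentz.
Variables (R : realType) (k : scalar_kind).
Local Notation F := (scalar_field R k).

Definition weight (w : nat -> R) : Prop := forall n, 0 < w n.

Definition primitive (w : nat -> R) (m : nat) : R := \sum_(j < m) w j.

(* [rearrangement f n] is a^*_(n+1): the least t >= 0 such that |f| exceeds t
   at no more than n indices. *)
Definition rearrangement (f : nat -> F) (n : nat) : R :=
  inf [set t | 0 <= t /\ exists A : {fset nat},
    (#|` A| <= n)%N /\ forall j, j \notin A -> modulus (f j) <= t].

Definition lorentz (q : \bar R) (w : nat -> R) (f : nat -> F) : \bar R :=
  match q with
  | r%:E => poweR (\sum_(0 <= n <oo)
        (rearrangement f n `^ r * primitive w n.+1 `^ (r - 1) * w n)%:E)%E r^-1
  | _ => ereal_sup
           (range (fun n => (rearrangement f n * primitive w n.+1)%:E))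
  end.

Definition first_coordinates (m : nat) (f : nat -> F) : nat -> F :=
  fun n => if (n < m)%N then f n else 0.

Definition d1_gauge (q : \bar R) (w : nat -> R) (f : nat -> F) : \bar R :=
  ereal_sup (range (fun m => lorentz q w (first_coordinates m f))).

Definition c0 (f : nat -> F) : Prop :=
  (fun n => modulus (f n)) @ \oo --> (0 : R).

(* As usual for Lorentz sequence spaces, elements of d_(1,q)(w) are null
   sequences.  If w is not summable, then a finite gauge already forces
   f \in c0.  If w is summable, the gauge is equivalent to the sup norm, and
   without the c0 condition d_(1,q)(w) would be l_infty, whose elements do not
   give convergent series against, e.g., the unit vector basis of c0. *)
Definition d1_space (q : \bar R) (w : nat -> R) : set (nat -> F) :=
  [set f | c0 f /\ (d1_gauge q w f < +oo)%E].

End Lorentz.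

Section Embeddings.
Variables (R : realType) (k : scalar_kind).
Local Notation F := (scalar_field R k).
Variables (X : lmodType F) (nrm : X -> R).
Variables (xx : nat -> X) (xs : nat -> {scalar X}).
Variables (S : set (nat -> F)) (N : (nat -> F) -> \bar R).

Definition embeds_into_X : Prop :=
  exists C : R, forall a : nat -> F, S a -> exists g : X,
    converges_to nrm (fun m => \sum_(n < m) a n *: xx n) g /\
    ((nrm g)%:E <= C%:E * N a)%E.

Definition X_embeds_into : Prop :=
  exists C : R, forall f : X, (N (fun n => xs n f) <= (C * nrm f)%:E)%E.

End Embeddings.

Definition lorentz_sandwich (R : realType) (k : scalar_kind)
    (X : lmodType (scalar_field R k)) (nrm : X -> R)
    (xx : nat -> X) (xs : nat -> {scalar X}) (q : R) (w : nat -> R) : Prop :=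
  embeds_into_X nrm xx (d1_space q%:E w) (d1_gauge q%:E w) /\
  X_embeds_into nrm xs (d1_gauge +oo%E w).

(* Main.v *)
(* For 0 < p <= 1 the weight [u n = s (n+1) ^ (p-1) * w n] has a primitive weight
   equivalent to [s ^ p], so that a unit vector sum over m indices has gauge
   equivalent to s m in d_(1,p)(w) and equal to s m in d_(1,oo)(w).  Testing the
   two embeddings on signed indicators gives (ii).  For (i), a finitely supported
   a is decomposed by the binary digits of its moduli relative to max |a_n|,
   which writes sum a_n x_n as a sum over k of max |a_n| 2^-k times a signed
   indicator of a subset of {|a_n| >= 2^-k max |a_n|}; p-convexity and exchange of
   summation then bound its norm by the gauge in d_(1,p)(w).  The other embedding
   holds because the m-th term of the rearrangement of the coefficients of f is
   the scalar in front of the signed indicator in U_m(f), whose norm is at least a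
   multiple of phi_u m by super-democracy. *)
Require Import Defs.
From mathcomp Require Import all_boot all_order all_algebra.
From mathcomp Require Import finmap complex.
From mathcomp Require Import all_classical all_reals all_analysis.
From mathcomp Require Import zify ring lra.
Import Order.TTheory GRing.Theory Num.Theory.
Import numFieldNormedType.Exports.
Local Open Scope ring_scope.

Set Implicit Arguments.
Unset Strict Implicit.
Unset Printing Implicit Defensive.

(** The gauge axioms depend only on a functional of the nonincreasing rearrangement, so they are
    proved once for an abstract functional and then specialised to the weighted power sum and the
    weighted supremum. The delicate axiom is the quasi-triangle inequality: it needs
    [primitive w m.*2] to be at most a multiple of [primitive w m], which fails for weights such as
    2^n. Here it is inherited from [phi_u], because a set of 2m indices splits into two sets of size
    m. In the binary decomposition, p-convexity produces powers (h s(N))^p, where h is the value of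
    a digit and N the number of indices carrying it. Replacing s(N)^p by the primitive of u at N
    makes the bound additive over indices, which permits the exchange of summation. Only finitely
    many digits are used; the remainder is made small according to the length of the support.
    Convergence of the series is a separate matter, settled by applying the finite bound to blocks
    of a null sequence and by completeness. *)

Section Scalars.
Variables (R : realType) (k : scalar_kind).
Local Notation F := (scalar_field R k).
Implicit Types (a b : F) (x y : R).

Lemma modulus_ge0 a : 0 <= modulus a.
Proof. by case: k a => /= a; [exact: normr_ge0 | case: a => ? ?; exact: sqrtr_ge0]. Qed.

Lemma modulusM a b : modulus (a * b) = modulus a * modulus b.
Proof. by case: k a b => /= a b; [exact: normrM | exact: ComplexField.Normc.normcM]. Qed.

Lemma modulusD a b : modulus (a + b) <= modulus a + modulus b.
Proof. by case: k a b => /= a b; [exact: ler_normD | exact: le_normcD]. Qed.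

Lemma modulus0 : modulus (0 : F) = 0.
Proof. by case: k => /=; [exact: normr0 | exact: ComplexField.Normc.normc0]. Qed.

Lemma modulus1 : modulus (1 : F) = 1.
Proof. by case: k => /=; [exact: normr1 | exact: ComplexField.Normc.normc1]. Qed.

Lemma modulus_eq0 a : modulus a = 0 -> a = 0.
Proof.
case: k a => /= a; first by move/eqP; rewrite normr_eq0 => /eqP.
exact: ComplexField.Normc.eq0_normc.
Qed.

Lemma modulus_gt0 a : a != 0 -> 0 < modulus a.
Proof.
by move=> a0; rewrite lt0r modulus_ge0 andbT; apply: contra a0 => /eqP/modulus_eq0->.
Qed.

Lemma modulus_of_real x : modulus (of_real k x) = `|x|.
Proof. by case: k => //=; rewrite expr0n /= addr0 sqrtr_sqr. Qed.

Lemma of_realD x y : of_real k (x + y) = of_real k x + of_real k y.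
Proof. by case: k => //=; rewrite rmorphD. Qed.

Lemma of_realM x y : of_real k (x * y) = of_real k x * of_real k y.
Proof. by case: k => //=; rewrite rmorphM. Qed.

Lemma of_real_modulus a : of_real k (modulus a) = `|a|.
Proof. by case: k a => //= -[]. Qed.

Lemma modulus_nat (b : bool) : modulus (b%:R : F) = b%:R.
Proof. by case: b; rewrite ?modulus1 ?modulus0. Qed.

Lemma modulusN1 : modulus (-1 : F) = 1.
Proof.
have : modulus (-1 : F) * modulus (-1 : F) = 1 by rewrite -modulusM mulrNN mulr1 modulus1.
by have := modulus_ge0 (-1); nra.
Qed.

Lemma modulus_sign a : modulus (sign a) = 1.
Proof.
rewrite /sign; case: eqVneq => [_|a0]; first exact: modulus1.
have m0 := modulus_gt0 a0.
apply: (mulIf (lt0r_neq0 m0)).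
rewrite -[X in _ * X](ger0_norm (modulus_ge0 a)) -modulus_of_real -modulusM of_real_modulus.
by rewrite divfK ?mul1r ?normr_eq0 // modulus_of_real ger0_norm // modulus_ge0.
Qed.

Lemma of_real_sign a : of_real k (modulus a) * sign a = a.
Proof.
rewrite /sign of_real_modulus; case: eqVneq => [->|a0]; first by rewrite normr0 mul0r.
by rewrite mulrC divfK // normr_eq0.
Qed.

End Scalars.

(** * Nonincreasing rearrangement of real sequences *)

Section DecreasingRearrangement.
Variable R : realType.
Implicit Types (b c : nat -> R) (A : {fset nat}).
Local Open Scope classical_set_scope.

Definition levels b (n : nat) : set R :=
  [set t | 0 <= t /\ exists A, (#|` A| <= n)%N /\ forall j, j \notin A -> b j <= t].

(** [rearrangement f] is convertible to [decr] of the moduli of [f]; working with real sequences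
    keeps the scalar field out of the estimates. *)
Definition decr b (n : nat) : R := inf (levels b n).

Lemma levels_lb b n : has_lbound (levels b n).
Proof. by exists 0 => t []. Qed.

Lemma decr_le b n A t : 0 <= t -> (#|` A| <= n)%N ->
  (forall j, j \notin A -> b j <= t) -> decr b n <= t.
Proof. by move=> t0 An At; apply: (ge_inf (levels_lb b n)); split=> //; exists A. Qed.

(** If [b] is unbounded, every [levels b n] is empty and [inf] returns the default 0; lower bounds
    for [decr] therefore need this property. *)
Definition bounded_above b := exists M, forall j, b j <= M.

Lemma levels_neq0 b n : bounded_above b -> levels b n !=set0.
Proof.
move=> [M bM]; exists (Num.max 0 M); split; first by rewrite le_max lexx.
by exists fset0; split=> // j _; rewrite le_max bM orbT.
Qed.

(** At most n exceptional indices cannot cover [A], and an index of [A] that is missed pushes the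
    level up to [t]. *)
Lemma decr_ge b n A t : bounded_above b -> (n < #|` A|)%N ->
  (forall j, j \in A -> t <= b j) -> t <= decr b n.
Proof.
move=> bb nA At; apply: lb_le_inf; first exact: levels_neq0.
move=> s [s0 [B [Bn Bs]]].
have [AB|/fsubsetPn[j jA jB]] := boolP (A `<=` B)%fset.
  by have := fsubset_leq_card AB; lia.
exact: le_trans (At j jA) (Bs j jB).
Qed.

Lemma decr_ge0 b n : 0 <= decr b n.
Proof.
have [E|/set0P ne] := eqVneq (levels b n) set0; first by rewrite /decr E inf0.
by apply: lb_le_inf => // t [].
Qed.

Lemma decr_nonincreasing b : bounded_above b ->
  {homo decr b : n m / (n <= m)%N >-> m <= n}.
Proof.
move=> bb n m nm; apply: lb_le_inf; first exact: levels_neq0.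
move=> t [t0 [A [An At]]]; apply: (decr_le t0 _ At); exact: leq_trans nm.
Qed.

Lemma decr_mono b c n : bounded_above c -> (forall j, b j <= c j) -> decr b n <= decr c n.
Proof.
move=> cb bc; apply: lb_le_inf; first exact: levels_neq0.
move=> t [t0 [A [An At]]]; apply: (decr_le t0 An) => j jA.
exact: le_trans (bc j) (At j jA).
Qed.

Lemma bounded_aboveZ (t : R) b : 0 <= t -> bounded_above b ->
  bounded_above (fun j => t * b j).
Proof. by move=> t0 [M bM]; exists (t * M) => j; apply: ler_wpM2l. Qed.

Lemma decrZ (t : R) b n : 0 <= t -> bounded_above b ->
  decr (fun j => t * b j) n = t * decr b n.
Proof.
(* One inequality for all nonnegative factors suffices: the reverse one is its instance for [t^-1]
   and the sequence [t * b]. *)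
suff le_decrZ s c : 0 <= s -> bounded_above c -> decr (fun j => s * c j) n <= s * decr c n.
  move=> t0 bb; apply/eqP; rewrite eq_le le_decrZ //=.
  have [->|tn0] := eqVneq t 0; first by rewrite mul0r decr_ge0.
  have tgt0 : 0 < t by rewrite lt0r tn0.
  have tb := bounded_aboveZ t0 bb.
  rewrite -ler_pdivlMl//; apply: le_trans (le_decrZ t^-1 _ _ tb); last by rewrite invr_ge0.
  apply: decr_mono => [|j]; first by apply: bounded_aboveZ; rewrite ?invr_ge0.
  by rewrite mulKf.
move=> {t b} s0 cb; have [s00|sn0] := eqVneq s 0.
  by rewrite s00 mul0r; apply: (@decr_le _ n fset0) => // j _; rewrite mul0r.
have sgt0 : 0 < s by rewrite lt0r sn0.
rewrite -ler_pdivrMl//; apply: lb_le_inf; first exact: levels_neq0.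
move=> t [t0 [A [An At]]]; rewrite ler_pdivrMl//; apply: (decr_le _ An).
  exact: mulr_ge0.
by move=> j jA; rewrite ler_wpM2l// At.
Qed.

(** The union of an exceptional set for [b] and one for [c] has at most n + m elements and is
    exceptional for the sum. *)
Lemma decrD b c n m : bounded_above b -> bounded_above c ->
  decr (fun j => b j + c j) (n + m) <= decr b n + decr c m.
Proof.
move=> bb cb; rewrite -lerBlDr; apply: lb_le_inf; first exact: levels_neq0.
move=> t [t0 [A [An At]]]; rewrite lerBlDr -lerBlDl.
apply: lb_le_inf; first exact: levels_neq0.
move=> s [s0 [B [Bn Bs]]]; rewrite lerBlDl.
apply: (@decr_le _ _ (A `|` B)%fset); first exact: addr_ge0.
  by have := cardfsUI A B; lia.
by move=> j; rewrite inE negb_or => /andP[jA jB]; apply: lerD; auto.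
Qed.

Lemma decr_comp b (s s' : nat -> nat) n : bounded_above b -> cancel s s' -> cancel s' s ->
  decr (b \o s) n <= decr b n.
Proof.
move=> bb ss' s's; apply: lb_le_inf; first exact: levels_neq0.
move=> t [t0 [A [An At]]].
apply: (@decr_le _ _ [fset s' x | x in A]%fset) => //.
  exact: leq_trans (leq_imfset_card _ s' (mem A)) An.
move=> j jA; apply: At; apply: contra jA => sjA.
by apply/imfsetP; exists (s j); rewrite ?ss'.
Qed.

Lemma decr_eq0 b m n : (forall j, (m <= j)%N -> b j = 0) -> (m <= n)%N -> decr b n = 0.
Proof.
move=> bm mn; apply/eqP; rewrite eq_le decr_ge0 andbT.
apply: (@decr_le _ _ [fset i in iota 0 m]%fset) => //.
  by apply: leq_trans mn; rewrite card_fseq (leq_trans (size_undup _))// size_iota.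
by move=> j; rewrite !inE mem_iota add0n /= -leqNgt => /bm ->.
Qed.

Lemma decr_indicator b A n : (forall j, b j = (j \in A)%:R) ->
  decr b n = (n < #|` A|)%N%:R.
Proof.
move=> bA; have bb : bounded_above b by exists 1 => j; rewrite bA; case: (_ \in _).
case: ltnP => nA; apply/eqP; rewrite eq_le.
  apply/andP; split; last by apply: (decr_ge bb nA) => j jA; rewrite bA jA.
  by apply: (@decr_le _ n fset0) => // j _; rewrite bA; case: (_ \in _).
rewrite decr_ge0 andbT; apply: (decr_le _ nA) => // j; rewrite bA => /negbTE ->//.
Qed.

End DecreasingRearrangement.

(** * Gauges built from a functional of the rearrangement *)

Section RearrangementGauge.
Variables (R : realType) (k : scalar_kind).
Local Notation F := (scalar_field R k).
Implicit Types (c d : nat -> R) (f g : nat -> F).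
Local Open Scope classical_set_scope.

(** The shape of rearrangements of finitely supported sequences. The gauge is a supremum over
    truncations, so a functional that behaves well on these sequences is enough. *)
Definition admissible c :=
  [/\ forall n, 0 <= c n, {homo c : n m / (n <= m)%N >-> m <= n} &
      exists m, forall n, (m <= n)%N -> c n = 0].

(** For a nonincreasing nonnegative [c], the condition [0 < c 0] says that [c] is nonzero, so the
    second clause is definiteness. *)
Definition sequence_norm (Lam : (nat -> R) -> \bar R) :=
  [/\ forall c, admissible c -> (0 <= Lam c < +oo)%E,
      forall c, admissible c -> 0 < c 0%N -> (0 < Lam c)%E,
      forall t c, 0 <= t -> admissible c -> Lam (fun n => t * c n)%R = (t%:E * Lam c)%E &
      forall c d, admissible c -> admissible d -> (forall n, c n <= d n) ->
        (Lam c <= Lam d)%E].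

(* The dilation [n./2] is what the inequality (f + g)^*_(2n) <= f^*_n + g^*_n
   turns into the quasi-triangle inequality for the gauge. *)
Definition quasi_subadditive (Lam : (nat -> R) -> \bar R) :=
  exists K : R, 1 <= K /\ forall c d, admissible c -> admissible d ->
    (Lam (fun n => c n./2 + d n./2)%R <= K%:E * (Lam c + Lam d))%E.

Variable Lam : (nat -> R) -> \bar R.
Hypothesis Lam_norm : sequence_norm Lam.

Definition moduli f : nat -> R := fun j => modulus (f j).

Definition rearrangement_gauge f : \bar R :=
  ereal_sup (range (fun m => Lam (decr (moduli (first_coordinates m f))))).
Local Notation N := rearrangement_gauge.

Definition supported (m : nat) f := forall j, (m <= j)%N -> f j = 0.

Lemma moduli_first m f j :
  moduli (first_coordinates m f) j = if (j < m)%N then modulus (f j) else 0.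
Proof. by rewrite /moduli /first_coordinates; case: ifP => //; rewrite modulus0. Qed.

Lemma supported_first m f : supported m (first_coordinates m f).
Proof. by move=> j mj; rewrite /first_coordinates ltnNge mj. Qed.

Lemma first_supported m M f : supported m f -> (m <= M)%N -> first_coordinates M f = f.
Proof.
move=> fm mM; apply/funext => j; rewrite /first_coordinates; case: ltnP => // Mj.
by rewrite fm// (leq_trans mM).
Qed.

Lemma bounded_moduli m f : supported m f -> bounded_above (moduli f).
Proof.
move=> fm; exists (\sum_(i < m) modulus (f i)) => j.
have [jm|mj] := ltnP j m; last first.
  by rewrite /moduli fm// modulus0 sumr_ge0// => i _; apply: modulus_ge0.
rewrite (bigD1 (Ordinal jm))//= lerDl sumr_ge0// => i _; exact: modulus_ge0.
Qed.

Lemma admissible_decr m f : supported m f -> admissible (decr (moduli f)).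
Proof.
move=> fm; split=> [n||]; first exact: decr_ge0.
  exact: decr_nonincreasing (bounded_moduli fm).
exists m => n mn; apply: decr_eq0 mn => j mj; by rewrite /moduli fm ?modulus0.
Qed.

Lemma admissible_first m f : admissible (decr (moduli (first_coordinates m f))).
Proof. exact: admissible_decr (@supported_first m f). Qed.

Lemma le_rearrangement_gauge m f : (Lam (decr (moduli (first_coordinates m f))) <= N f)%E.
Proof. by apply: ereal_sup_ubound; exists m. Qed.

Lemma rearrangement_gauge_supported m f : supported m f -> N f = Lam (decr (moduli f)).
Proof.
move=> fm; apply/eqP; rewrite eq_le; apply/andP; split; last first.
  by rewrite -{1}(first_supported fm (leqnn m)) le_rearrangement_gauge.
apply: ge_ereal_sup => _ [M _ <-].
case: Lam_norm => _ _ _ Lmono.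
apply: Lmono; [exact: admissible_first|exact: admissible_decr fm|move=> n].
apply: decr_mono; first exact: bounded_moduli fm.
by move=> j; rewrite moduli_first; case: ifP => // _; exact: modulus_ge0.
Qed.

Lemma rearrangement_gauge_ge0 f : (0 <= N f)%E.
Proof.
case: Lam_norm => L0 _ _ _.
by apply: le_trans (le_rearrangement_gauge 0 f); have /andP[] := L0 _ (admissible_first 0 f).
Qed.

Lemma rearrangement_gauge_mono f g :
  (forall n, modulus (g n) <= modulus (f n)) -> (N g <= N f)%E.
Proof.
case: Lam_norm => _ _ _ Lmono gf; apply: ge_ereal_sup => _ [m _ <-].
apply: le_trans (le_rearrangement_gauge m f).
apply: Lmono; [exact: admissible_first..|move=> n].
apply: decr_mono; first exact: bounded_moduli (@supported_first m f).
by move=> j; rewrite !moduli_first; case: ifP.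
Qed.

Lemma rearrangement_gaugeZ (t : F) f : N (fun n => t * f n) = ((modulus t)%:E * N f)%E.
Proof.
case: Lam_norm => L0 _ LZ _.
have ML m : Lam (decr (moduli (first_coordinates m (fun n => t * f n)))) =
            ((modulus t)%:E * Lam (decr (moduli (first_coordinates m f))))%E.
  rewrite -LZ ?modulus_ge0//; last exact: admissible_first.
  congr (Lam _); apply/funext => n.
  rewrite -decrZ ?modulus_ge0//; last exact: bounded_moduli (@supported_first m f).
  congr (decr _ _); apply/funext => j; rewrite !moduli_first.
  by case: ifP => //; rewrite ?mulr0// modulusM.
(* Division by [modulus t] is impossible here, and [N f] may be infinite. The zero sequence is
   written as [0 * 0], and homogeneity of [Lam] gives it the value 0. *)
have [/modulus_eq0 t0|tn0] := eqVneq (modulus t) 0.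
  rewrite t0 modulus0 mul0e.
  rewrite (_ : (fun _ => _) = fun=> 0); last by apply/funext => n; rewrite mul0r.
  rewrite (@rearrangement_gauge_supported 0)//.
  have <- : (fun n : nat => 0 * (0 : R)) = decr (moduli (fun _ : nat => 0 : F)).
    apply/funext => n; rewrite mul0r; apply/esym/(@decr_eq0 _ _ 0) => // j _.
    by rewrite /moduli modulus0.
  rewrite LZ ?mul0e//; split=> //; by exists 0%N.
have tgt0 : 0 < modulus t by rewrite lt0r tn0 modulus_ge0.
apply/eqP; rewrite eq_le; apply/andP; split.
  apply: ge_ereal_sup => _ [m _ <-]; rewrite ML lee_pmul2l ?lte_fin//.
  exact: le_rearrangement_gauge.
rewrite -lee_pdivlMl//; apply: ge_ereal_sup => _ [m _ <-].
by rewrite lee_pdivlMl// -ML le_rearrangement_gauge.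
Qed.

Lemma rearrangement_gauge_gt0 f : (exists n, f n != 0) -> (0 < N f)%E.
Proof.
case: Lam_norm => _ Lpos _ _ [n fn0].
apply: lt_le_trans (le_rearrangement_gauge n.+1 f).
apply: Lpos; first exact: admissible_first.
apply: lt_le_trans (modulus_gt0 fn0) _.
apply: (@decr_ge _ _ _ [fset n]%fset).
- exact: bounded_moduli (@supported_first _ _).
- by rewrite cardfs1.
- by move=> j; rewrite inE => /eqP ->; rewrite moduli_first ltnSn.
Qed.

Lemma rearrangement_gauge_fin m f : supported m f -> (N f < +oo)%E.
Proof.
case: Lam_norm => L0 _ _ _ fm; rewrite (rearrangement_gauge_supported fm).
by have /andP[] := L0 _ (admissible_decr fm).
Qed.

Lemma supported_fset (A : {fset nat}) : exists m, forall j, j \in A -> (j < m)%N.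
Proof.
exists (\max_(i <- A) i).+1 => j jA; rewrite ltnS.
exact: (leq_bigmax_seq (F := id)).
Qed.

(** A truncation involves m coordinates only, so for r < 1 a single index J makes [a n J] at least
    [r * b n] on all of them. Homogeneity of [Lam] carries the factor r outside, and r is
    arbitrarily close to 1. *)
Lemma rearrangement_gauge_fatou : fatou_property N.
Proof.
move=> a b a0 amono ab.
have le_ab n j : a n j <= b n.
  rewrite -(cvg_lim (@Rhausdorff R) (ab n)).
  apply: nondecreasing_cvgn_le; first exact: amono.
  by apply/cvg_ex; exists (b n); exact: ab.
have Na_mono : {homo (fun j => N (fun n => of_real k (a n j))) : i j / (i <= j)%N >-> (i <= j)%E}.
  move=> i j ij; apply: rearrangement_gauge_mono => n.
  by rewrite !modulus_of_real !ger0_norm// amono.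
suff -> : N (fun n => of_real k (b n)) =
    ereal_sup (range (fun j => N (fun n => of_real k (a n j)))).
  exact: ereal_nondecreasing_cvgn.
have b0 n : 0 <= b n := le_trans (a0 n 0%N) (le_ab n 0%N).
apply/eqP; rewrite eq_le; apply/andP; split; last first.
  apply: ge_ereal_sup => _ [j _ <-]; apply: rearrangement_gauge_mono => n.
  by rewrite !modulus_of_real !ger0_norm.
apply: ge_ereal_sup => _ [m _ <-].
case: (Lam_norm) => L0 _ LZ Lmono.
apply/lee_mul01Pr; first by have /andP[] := L0 _ (admissible_first m (fun n => of_real k (b n))).
move=> r /andP[r0 r1].
have [J HJ] : exists J, forall n, (n < m)%N -> r * b n <= a n J.
  elim: m => [|m [J HJ]]; first by exists 0%N.
  have [J' HJ'] : exists J', r * b m <= a m J'.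
    have [bm0|bmn0] := eqVneq (b m) 0; first by exists 0%N; rewrite bm0 mulr0.
    have /(cvgr_gt (b m))/(_ (r * b m)) := ab m.
    rewrite gtr_pMl ?lt0r ?bmn0 ?b0// => /(_ r1) [J' _ HJ'].
    by exists J'; apply/ltW/HJ' => /=.
  exists (maxn J J') => n; rewrite ltnS leq_eqVlt => /predU1P[->|nm].
    apply: le_trans HJ' _; apply: amono; exact: leq_maxr.
  by apply: le_trans (HJ _ nm) _; apply: amono; exact: leq_maxl.
apply: (@le_trans _ _ (N (fun n => of_real k (a n J)))); last by apply: ereal_sup_ubound; exists J.
apply: le_trans (le_rearrangement_gauge m _).
rewrite -LZ ?(ltW r0)//; last exact: admissible_first.
have aux : (fun n => r * decr (moduli (first_coordinates m (fun n => of_real k (b n)))) n)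
   = decr (fun j => r * moduli (first_coordinates m (fun n => of_real k (b n))) j).
  apply/funext => n; rewrite decrZ ?(ltW r0)//; exact: bounded_moduli (@supported_first _ _).
rewrite aux.
apply: Lmono; last first.
- move=> n; apply: decr_mono; first exact: bounded_moduli (@supported_first _ _).
  move=> j; rewrite !moduli_first; case: ifP; rewrite ?mulr0// => jm.
  by rewrite !modulus_of_real !ger0_norm// HJ.
- exact: admissible_first.
rewrite -aux; have [c0 cm [M cM]] := admissible_first m (fun n => of_real k (b n)).
split=> [n|i j ij|]; first by rewrite mulr_ge0// ltW.
  by rewrite ler_wpM2l ?(ltW r0)// cm.
by exists M => n /cM ->; rewrite mulr0.
Qed.

Lemma rearrangement_gauge_is_gauge : is_gauge N.
Proof.
split.
- exact: rearrangement_gauge_ge0.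
- exact: rearrangement_gauge_gt0.
- exact: rearrangement_gaugeZ.
- exact: rearrangement_gauge_mono.
- split; last exact: rearrangement_gauge_fatou.
  move=> A; have [m Am] := supported_fset A.
  apply: (@rearrangement_gauge_fin m) => j mj; rewrite /indicator_seq.
  by case: (boolP (j \in A)) => // /Am; rewrite ltnNge mj.
Qed.

Lemma rearrangement_gauge_quasi_banach :
  quasi_subadditive Lam -> quasi_banach_function_space N.
Proof.
move=> [K [K1 LK]]; split; first exact: rearrangement_gauge_is_gauge.
case: (Lam_norm) => L0 _ _ Lmono.
have K0 : 0 <= K by apply: le_trans K1.
exists K; split=> // f g; apply: ge_ereal_sup => _ [m _ <-].
set c := decr (moduli (first_coordinates m f)); set d := decr (moduli (first_coordinates m g)).
have ac : admissible c := admissible_first m f.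
have ad : admissible d := admissible_first m g.
apply: le_trans (_ : K%:E * (Lam c + Lam d) <= _)%E; last first.
  by rewrite lee_wpmul2l ?lee_fin// leeD ?le_rearrangement_gauge.
apply: le_trans (LK _ _ ac ad); apply: Lmono.
- exact: admissible_first.
- case: ac ad => c0 cmono [M cM] [d0 dmono [M' dM']]; split.
  + by move=> n; rewrite addr_ge0.
  + by move=> i j ij; rewrite lerD// ?cmono// ?dmono//; lia.
  + by exists (maxn M M').*2 => n Mn; rewrite cM ?dM' ?addr0//; lia.
- move=> n.
  have bf := bounded_moduli (@supported_first m f).
  have bg := bounded_moduli (@supported_first m g).
  apply: le_trans (decrD n./2 n./2 bf bg).
  set b := (X in decr X (n./2 + n./2)).
  have bb : bounded_above b.
    by case: bf bg => [M HM] [M' HM']; exists (M + M') => j; apply: lerD.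
  (* For odd n the two halves add up to n - 1; monotonicity of the rearrangement makes up the
     difference. *)
  apply: le_trans (decr_nonincreasing bb (_ : n./2 + n./2 <= n)%N); last lia.
  apply: decr_mono => // j; rewrite /b !moduli_first; case: ifP; rewrite ?addr0// => _.
  exact: modulusD.
Qed.

(** A truncation of [f \o s] sees finitely many values of [f], all kept by some longer truncation of
    [f]. This yields one inequality; the other is the same one for the inverse permutation. *)
Lemma rearrangement_gauge_symmetric : symmetric_gauge N.
Proof.
case: (Lam_norm) => L0 _ _ Lmono.
suff le_comp s f : bijective s -> (N (f \o s) <= N f)%E.
  move=> s f bs; apply/eqP; rewrite eq_le le_comp//=.
  have [s' ss' s's] := bs; rewrite {1}(_ : f = (f \o s) \o s').
    by apply: le_comp; exists s.
  by apply/funext => j /=; rewrite s's.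
case=> s' ss' s's; apply: ge_ereal_sup => _ [m _ <-].
have [M HM] : exists M, forall j, (j < m)%N -> (s j < M)%N.
  exists (\max_(i < m) s i).+1 => j jm; rewrite ltnS.
  exact: (leq_bigmax (Ordinal jm)).
apply: le_trans (le_rearrangement_gauge M f); apply: Lmono; [exact: admissible_first..|move=> n].
have bb := bounded_moduli (@supported_first M f).
apply: le_trans (decr_comp n bb ss' s's); apply: decr_mono.
  by case: bb => B HB; exists B => j; exact: HB.
move=> j /=; rewrite !moduli_first; case: ifP => [/HM ->//|_].
by case: ifP => _ //; exact: modulus_ge0.
Qed.

End RearrangementGauge.

(** * Inequalities for real powers *)

Section Powers.
Variable R : realType.
Implicit Types x y q r : R.

Lemma powR_le r x y : 0 <= r -> 0 <= x -> x <= y -> x `^ r <= y `^ r.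
Proof.
move=> r0 x0 xy; apply: ge0_ler_powR => //; rewrite nnegrE//; exact: le_trans xy.
Qed.

Lemma powRK x q : q != 0 -> 0 <= x -> (x `^ q) `^ q^-1 = x.
Proof. by move=> q0 x0; rewrite -powRrM mulfV// powRr1. Qed.

Lemma powRVK x q : q != 0 -> 0 <= x -> (x `^ q^-1) `^ q = x.
Proof. by move=> q0 x0; rewrite -powRrM mulVf// powRr1. Qed.

Lemma powR_addr_le x y r : 0 <= r -> 0 <= x -> 0 <= y ->
  (x + y) `^ r <= 2 `^ r * (x `^ r + y `^ r).
Proof.
move=> r0 x0 y0; wlog xy : x y x0 y0 / x <= y.
  move=> H; have [xy|yx] := leP x y; first exact: H.
  by rewrite addrC [X in _ * X]addrC; apply: H => //; exact: ltW.
apply: (@le_trans _ _ ((2 * y) `^ r)); first by apply: powR_le => //; lra.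
by rewrite powRM// ler_wpM2l ?powR_ge0// lerDr powR_ge0.
Qed.

Lemma le1_powR x q : 0 <= x <= 1 -> 0 < q <= 1 -> x <= x `^ q.
Proof.
move=> /andP[x0 x1] /andP[q0 q1]; have [->|xn0] := eqVneq x 0.
  by rewrite powR0// gt_eqF.
by apply: ger1_powR => //; rewrite lt0r xn0 x0.
Qed.

(** A concave power lies below its tangent at 1. The proof reads this off from Young's inequality
    for the product of [x ^ q] and 1, with exponents 1/q and 1/(1 - q). *)
Lemma powR_tangent x q : 0 <= x -> 0 < q <= 1 -> x `^ q <= q * x + (1 - q).
Proof.
move=> x0 /andP[q0]; rewrite le_eqVlt => /predU1P[->|q1]; first by rewrite powRr1//; lra.
have q1' : 0 < (1 - q)^-1 by rewrite invr_gt0 subr_gt0.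
have := @conjugate_powR R (x `^ q) 1 q^-1 (1 - q)^-1 (powR_ge0 _ _) ler01.
rewrite invr_gt0 q0 q1' !invrK => /(_ isT isT); rewrite addrC subrK => /(_ erefl).
by rewrite mulr1 powRK ?gt_eqF// powR1 mul1r mulrC.
Qed.
End Powers.

(** * Comparison of the primitive of the Lorentz weight with a power of the primitive weight *)

Section PrimitiveWeights.
Variable R : realType.
Implicit Types (w u v : nat -> R) (q : R).
Local Notation s := primitive.

Lemma primitive0 w : s w 0 = 0. Proof. by rewrite /primitive big_ord0. Qed.

Lemma primitiveS w m : s w m.+1 = s w m + w m.
Proof. by rewrite /primitive big_ord_recr. Qed.

Lemma primitive_ge0 w m : weight w -> 0 <= s w m.
Proof. by move=> w0; apply: sumr_ge0 => i _; exact: ltW. Qed.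

Lemma primitive_gt0 w m : weight w -> (0 < m)%N -> 0 < s w m.
Proof.
by case: m => // m w0 _; rewrite primitiveS; apply: ltr_wpDl; [exact: primitive_ge0|exact: w0].
Qed.

Lemma primitive_mono w m n : weight w -> (m <= n)%N -> s w m <= s w n.
Proof.
move=> w0 /subnKC <-; elim: (n - m)%N => [|i IH]; first by rewrite addn0.
by rewrite addnS primitiveS; apply: le_trans IH _; rewrite lerDl ltW.
Qed.

(* Abel summation. *)
Lemma sum_nonincreasing_le u v c m :
  (forall n, 0 <= c n) -> {homo c : i j / (i <= j)%N >-> j <= i} ->
  (forall n, s u n <= s v n) ->
  \sum_(n < m) c n * u n <= \sum_(n < m) c n * v n.
Proof.
move=> c0 cm uv.
(* The induction needs the boundary term of the partial summation: since [c] decreases, the surplus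
   of [v] over [u] collected so far may be carried on with the smaller coefficient [c m]. *)
suff : c m.-1 * (s v m - s u m) <= \sum_(n < m) c n * v n - \sum_(n < m) c n * u n.
  by move=> H; rewrite -subr_ge0; apply: le_trans H; rewrite mulr_ge0// subr_ge0.
elim: m => [|m IH]; first by rewrite !big_ord0 !primitive0 !subrr mulr0.
rewrite !big_ord_recr/= !primitiveS.
have H : c m * (s v m - s u m) <= c m.-1 * (s v m - s u m).
  by apply: ler_wpM2r; rewrite ?subr_ge0// cm// leq_pred.
have := le_trans H IH; lra.
Qed.

(** A discrete derivative of s^q / q, which is why its primitive is comparable to s^q. *)
Definition lorentz_weight q w n : R := s w n.+1 `^ (q - 1) * w n.

Lemma lorentz_weight_gt0 q w : weight w -> weight (lorentz_weight q w).
Proof. by move=> w0 n; rewrite mulr_gt0// powR_gt0// primitive_gt0. Qed.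

(** In terms of the ratio x = s(n) / s(n+1), which lies in [0, 1], the increment is s(n+1)^q (1 -
    x), while that of s^q is s(n+1)^q (1 - x^q). The comparison becomes an inequality in one
    variable. *)
Lemma lorentz_weightE q w n : weight w -> 0 < q ->
  lorentz_weight q w n = s w n.+1 `^ q * (1 - s w n / s w n.+1).
Proof.
move=> w0 q0; have S0 := primitive_gt0 w0 (ltn0Sn n).
rewrite /lorentz_weight -(@mulr_powRB1 _ _ q) ?ltW//.
have -> : w n = s w n.+1 - s w n by rewrite primitiveS addrAC subrr add0r.
field; exact: lt0r_neq0.
Qed.

Lemma powR_primitiveB q w n : weight w -> 0 < q ->
  s w n `^ q = s w n.+1 `^ q * (s w n / s w n.+1) `^ q.
Proof.
move=> w0 q0; have S0 := primitive_gt0 w0 (ltn0Sn n).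
rewrite -powRM ?divr_ge0 ?primitive_ge0 ?ltW//.
by rewrite mulrC divfK// gt_eqF.
Qed.

Lemma primitive_ratio w n : weight w -> 0 <= s w n / s w n.+1 <= 1.
Proof.
move=> w0; have S0 := primitive_gt0 w0 (ltn0Sn n).
by rewrite divr_ge0 ?primitive_ge0// ler_pdivrMr// mul1r primitive_mono.
Qed.

(** Increment by increment, from 1 - x^q <= 1 - x. *)
Lemma primitive_lorentz_weight_ge q w m : weight w -> 0 < q <= 1 ->
  s w m `^ q <= s (lorentz_weight q w) m.
Proof.
move=> w0 /andP[q0 q1]; elim: m => [|m IH]; first by rewrite !primitive0 powR0 ?gt_eqF.
rewrite [s (lorentz_weight q w) _]primitiveS -lerBlDl.
apply: le_trans (_ : s w m.+1 `^ q - s w m `^ q <= _).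
  by rewrite lerD2l lerN2.
rewrite lorentz_weightE// (powR_primitiveB m w0 q0) -{1}[_ `^ q]mulr1 -mulrBr.
rewrite ler_wpM2l ?powR_ge0// lerD2l lerN2.
by apply: le1_powR; [exact: primitive_ratio|rewrite q0].
Qed.

(** Increment by increment, from the tangent inequality in the form q (1 - x) <= 1 - x^q. *)
Lemma primitive_lorentz_weight_le q w m : weight w -> 0 < q <= 1 ->
  s (lorentz_weight q w) m <= q^-1 * s w m `^ q.
Proof.
move=> w0 /andP[q0 q1]; rewrite ler_pdivlMl//.
elim: m => [|m IH]; first by rewrite !primitive0 mulr0 powR_ge0.
rewrite [s (lorentz_weight q w) _]primitiveS mulrDr -lerBrDl.
apply: le_trans (_ : s w m.+1 `^ q - s w m `^ q <= _); last first.
  by rewrite lerD2l lerN2.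
rewrite lorentz_weightE// (powR_primitiveB m w0 q0) -{2}[_ `^ q]mulr1 -mulrBr mulrCA.
rewrite ler_wpM2l ?powR_ge0//.
have /andP[x0 x1] := primitive_ratio m w0.
have := @powR_tangent _ (s w m / s w m.+1) q x0; rewrite q0 q1 => /(_ isT).
by set y := _ `^ q; lra.
Qed.

(** For q >= 1 the factors s(j)^(q-1) increase with j, so each is at most s(m)^(q-1). *)
Lemma primitive_lorentz_weight_le1 q w m : weight w -> 1 <= q ->
  s (lorentz_weight q w) m <= s w m `^ q.
Proof.
move=> w0 q1; have q0 : 0 < q by apply: lt_le_trans q1.
case: m => [|m]; first by rewrite primitive0 powR_ge0.
rewrite -(@mulr_powRB1 _ _ q) ?primitive_ge0// {1 2}/s mulr_suml; apply: ler_sum => i _.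
rewrite /lorentz_weight mulrC; apply: ler_wpM2l; first exact: ltW.
apply: powR_le; [by rewrite subr_ge0|exact: primitive_ge0|exact: primitive_mono].
Qed.

End PrimitiveWeights.

(** * The weighted power sum and the weighted supremum as functionals *)

Section SequenceNorms.
Variable R : realType.
Implicit Types (c d u w : nat -> R) (q : R).

Definition weighted_norm q u c : \bar R :=
  poweR (\sum_(0 <= n <oo) (c n `^ q * u n)%:E)%E q^-1.

Definition weighted_sup w c : \bar R :=
  ereal_sup (range (fun n => (c n * primitive w n.+1)%:E)).

Definition doubling v := exists D : R, forall m, primitive v m.*2 <= D * primitive v m.

Lemma weighted_norm_finite q u c m : 0 < q -> weight u ->
  (forall n, (m <= n)%N -> c n = 0) ->
  weighted_norm q u c = ((\sum_(n < m) c n `^ q * u n) `^ q^-1)%:E.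
Proof.
move=> q0 u0 cm; rewrite /weighted_norm (nneseries_split 0 m); last first.
  by move=> n _; rewrite lee_fin mulr_ge0 ?powR_ge0// ltW.
rewrite add0n eseries0 ?adde0; last first.
  by move=> n mn _; rewrite cm// powR0 ?gt_eqF// mul0r.
by rewrite sumEFin big_mkord.
Qed.

Lemma sum_powR_double q u c m :
  \sum_(n < m.*2) c n./2 `^ q * u n = \sum_(n < m) c n `^ q * (u n.*2 + u n.*2.+1).
Proof.
elim: m => [|m IH]; first by rewrite !big_ord0.
rewrite doubleS !big_ord_recr/= IH mulrDr addrA.
by rewrite uphalf_double doubleK.
Qed.

Lemma primitive_double u m :
  primitive (fun n => u n.*2 + u n.*2.+1) m = primitive u m.*2.
Proof.
elim: m => [|m IH]; first by rewrite !primitive0.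
by rewrite doubleS !primitiveS IH addrA.
Qed.

Lemma admissibweighted_sup_geport2 c d : admissible c -> admissible d ->
  exists m, (forall n, (m <= n)%N -> c n = 0) /\ (forall n, (m <= n)%N -> d n = 0).
Proof.
case=> _ _ [m cm] [_ _ [m' dm']]; exists (maxn m m').
by split=> n; rewrite geq_max => /andP[? ?]; auto.
Qed.

Lemma primitiveZ (D : R) u m : primitive (fun n => D * u n) m = D * primitive u m.
Proof. by rewrite /primitive mulr_sumr. Qed.

Lemma weighted_norm_sequence_norm q u : 0 < q -> weight u ->
  sequence_norm (weighted_norm q u).
Proof.
move=> q0 u0; have q0' : 0 <= q^-1 by rewrite invr_ge0 ltW.
have S_ge0 c m : 0 <= \sum_(n < m) c n `^ q * u n.
  by apply: sumr_ge0 => i _; rewrite mulr_ge0 ?powR_ge0// ltW.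
split.
- move=> c [c0 _ [m cm]].
  by rewrite (weighted_norm_finite q0 u0 cm) lee_fin powR_ge0 ltry.
- move=> c [c0 _ [m cm]] c0pos; case: m cm => [|m] cm.
    by move: c0pos; rewrite cm// ltxx.
  rewrite (weighted_norm_finite q0 u0 cm) lte_fin powR_gt0// big_ord_recl.
  apply: ltr_pwDl; first by rewrite mulr_gt0 ?powR_gt0.
  by apply: sumr_ge0 => i _; rewrite mulr_ge0 ?powR_ge0// ltW.
- move=> t c t0 [c0 _ [m cm]].
  rewrite (weighted_norm_finite q0 u0 cm) (@weighted_norm_finite _ _ _ m)//; last first.
    by move=> n mn; rewrite cm// mulr0.
  rewrite -EFinM -[X in _ = (X * _)%:E](@powRK _ t q) ?gt_eqF// -powRM ?powR_ge0//.
  congr (_ `^ _)%:E; rewrite mulr_sumr; apply: eq_bigr => i _.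
  by rewrite powRM// mulrA.
- move=> c d ac ad cd; have [m [cm dm]] := admissibweighted_sup_geport2 ac ad.
  case: ac => c0 _ _.
  rewrite (weighted_norm_finite q0 u0 cm) (weighted_norm_finite q0 u0 dm) lee_fin.
  apply: powR_le => //; apply: ler_sum => i _; apply: ler_wpM2r; first exact: ltW.
  by apply: powR_le => //; exact: ltW.
Qed.

(** The dilated sequence repeats each value at the indices 2n and 2n + 1. The weight merged over
    these pairs has primitive [primitive u m.*2], at most [D * primitive u m], so Abel summation
    against nonincreasing powers replaces it by [D * u]. *)
Lemma weighted_norm_quasi_subadditive q u : 0 < q -> weight u -> doubling u ->
  quasi_subadditive (weighted_norm q u).
Proof.
move=> q0 u0 [D uD]; have q0' : 0 <= q^-1 by rewrite invr_ge0 ltW.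
have S_ge0 c m : 0 <= \sum_(n < m) c n `^ q * u n.
  by apply: sumr_ge0 => i _; rewrite mulr_ge0 ?powR_ge0// ltW.
have D0 : 0 <= D.
  rewrite -(pmulr_lge0 _ (primitive_gt0 u0 (ltn0Sn 0))).
  exact: le_trans (primitive_ge0 _ u0) (uD _).
(* [D] is the doubling constant, the first power of 2 splits (c + d)^q inside the sum, and the last
   one splits the outer root. *)
pose K := (D * 2 `^ q) `^ q^-1 * 2 `^ q^-1.
exists (Num.max 1 K); split; first by rewrite le_max lexx.
move=> c d ac ad; have [m [cm dm]] := admissibweighted_sup_geport2 ac ad.
rewrite (weighted_norm_finite q0 u0 cm) (weighted_norm_finite q0 u0 dm).
rewrite (@weighted_norm_finite _ _ _ m.*2)//; last first.
  by move=> n mn; rewrite cm ?dm ?addr0//; lia.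
case: ac ad => c0 cmono _ [d0 dmono _].
rewrite -EFinD -EFinM lee_fin.
set A := \sum_(n < m) c n `^ q * u n; set B := \sum_(n < m) d n `^ q * u n.
have A0 : 0 <= A by exact: S_ge0.
have B0 : 0 <= B by exact: S_ge0.
apply: (@le_trans _ _ (K * (A `^ q^-1 + B `^ q^-1))); last first.
  by rewrite ler_wpM2r ?addr_ge0 ?powR_ge0// le_max lexx orbT.
apply: (@le_trans _ _ ((D * 2 `^ q * (A + B)) `^ q^-1)); last first.
  rewrite powRM ?addr_ge0 ?mulr_ge0 ?powR_ge0// /K -mulrA ler_wpM2l ?powR_ge0//.
  exact: powR_addr_le.
apply: powR_le => //; first by apply: sumr_ge0 => i _; rewrite mulr_ge0 ?powR_ge0// ltW.
rewrite (sum_powR_double _ _ (fun n => c n + d n)).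
apply: (@le_trans _ _ (\sum_(n < m) (c n + d n) `^ q * (D * u n))).
  apply: (@sum_nonincreasing_le R (fun n => u n.*2 + u n.*2.+1) (fun n => D * u n)
    (fun n => (c n + d n) `^ q) m).
  + by move=> n; exact: powR_ge0.
  + move=> i j ij; apply: powR_le; [exact: ltW|exact: addr_ge0|].
    by rewrite lerD ?cmono ?dmono.
  + by move=> n; rewrite primitive_double primitiveZ.
rewrite /A /B -big_split/= mulr_sumr; apply: ler_sum => i _.
rewrite mulrCA -mulrA ler_wpM2l// -mulrDl mulrA; apply: ler_wpM2r; first exact: ltW.
by apply: powR_addr_le => //; exact: ltW.
Qed.

Lemma weighted_sup_ge w c n : ((c n * primitive w n.+1)%:E <= weighted_sup w c)%E.
Proof. by apply: ereal_sup_ubound; exists n. Qed.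

Lemma weighted_sup_ge0 w c : weight w -> admissible c -> (0 <= weighted_sup w c)%E.
Proof.
move=> w0 [c0 _ _]; apply: le_trans (weighted_sup_ge w c 0).
by rewrite lee_fin mulr_ge0// primitive_ge0.
Qed.

Lemma weighted_sup_sequence_norm w : weight w -> sequence_norm (weighted_sup w).
Proof.
move=> w0.
split.
- move=> c ac; rewrite weighted_sup_ge0//=; case: ac => c0 cmono [m cm].
  apply: (@le_lt_trans _ _ (c 0%N * primitive w m)%:E); last exact: ltry.
  apply: ge_ereal_sup => _ [n _ <-]; rewrite lee_fin.
  have [mn|nm] := leqP m n; first by rewrite cm// mul0r mulr_ge0// primitive_ge0.
  by rewrite ler_pM ?primitive_ge0// ?cmono// primitive_mono.
- move=> c [c0 _ _] c0pos; apply: lt_le_trans (weighted_sup_ge w c 0%N).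
  by rewrite lte_fin mulr_gt0// primitive_gt0.
- move=> t c t0 ac; have [->|tn0] := eqVneq t 0.
    apply/eqP; rewrite mul0e eq_le; apply/andP; split.
      by apply: ge_ereal_sup => _ [n _ <-]; rewrite !mul0r.
    by apply: le_trans (weighted_sup_ge w _ 0%N); rewrite !mul0r.
  have tgt0 : 0 < t by rewrite lt0r tn0.
  apply/eqP; rewrite eq_le; apply/andP; split.
    apply: ge_ereal_sup => _ [n _ <-].
    by rewrite -mulrA EFinM lee_pmul2l ?lte_fin// weighted_sup_ge.
  rewrite -lee_pdivlMl//; apply: ge_ereal_sup => _ [n _ <-].
  rewrite lee_pdivlMl// -EFinM mulrA; exact: (weighted_sup_ge w (fun n => t * c n)).
- move=> c d [c0 _ _] _ cd; apply: ge_ereal_sup => _ [n _ <-].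
  by apply: le_trans (weighted_sup_ge w d n); rewrite lee_fin ler_wpM2r ?primitive_ge0.
Qed.

(** Since n + 1 <= 2 (n./2 + 1), doubling bounds [primitive w n.+1] by the value at the index paired
    with [c n./2] and [d n./2]. *)
Lemma weighted_sup_quasi_subadditive w : weight w -> doubling w ->
  quasi_subadditive (weighted_sup w).
Proof.
move=> w0 [D wD].
have D0 : 0 <= D.
  rewrite -(pmulr_lge0 _ (primitive_gt0 w0 (ltn0Sn 0))).
  exact: le_trans (primitive_ge0 _ w0) (wD _).
exists (Num.max 1 D); split; first by rewrite le_max lexx.
move=> c d ac ad; apply: ge_ereal_sup => _ [n _ <-].
apply: (@le_trans _ _ (D%:E * (weighted_sup w c + weighted_sup w d))%E); last first.
  by rewrite lee_wpmul2r ?adde_ge0 ?weighted_sup_ge0// lee_fin le_max lexx orbT.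
apply: (@le_trans _ _ (D * (c n./2 * primitive w n./2.+1 + d n./2 * primitive w n./2.+1))%:E).
  case: ac ad => c0 _ _ [d0 _ _].
  rewrite lee_fin -mulrDl mulrCA ler_wpM2l ?addr_ge0//.
  by apply: le_trans (wD _); apply: primitive_mono => //; lia.
by rewrite EFinM lee_wpmul2l ?lee_fin// EFinD leeD// weighted_sup_ge.
Qed.

Lemma lorentz_weight_doubling q w : 0 < q <= 1 -> weight w -> doubling w ->
  doubling (lorentz_weight q w).
Proof.
move=> q01 w0 [D wD]; have /andP[q0 q1] := q01.
have D0 : 0 <= D.
  rewrite -(pmulr_lge0 _ (primitive_gt0 w0 (ltn0Sn 0))).
  exact: le_trans (primitive_ge0 _ w0) (wD _).
exists (q^-1 * D `^ q) => m.
apply: le_trans (primitive_lorentz_weight_le _ w0 q01) _.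
rewrite -mulrA; apply: ler_wpM2l; first by rewrite invr_ge0 ltW.
apply: (@le_trans _ _ ((D * primitive w m) `^ q)).
  by apply: powR_le; rewrite ?primitive_ge0// ltW.
rewrite powRM ?primitive_ge0// ler_wpM2l ?powR_ge0//.
exact: primitive_lorentz_weight_ge.
Qed.

End SequenceNorms.

(** * The Lorentz gauges as rearrangement gauges *)

Section LorentzGauges.
Variables (R : realType) (k : scalar_kind).
Local Notation F := (scalar_field R k).
Implicit Types (w : nat -> R) (q : R).

Lemma d1_gaugeE q w :
  @d1_gauge R k q%:E w = rearrangement_gauge (weighted_norm q (lorentz_weight q w)).
Proof.
apply/funext => f; rewrite /d1_gauge /rearrangement_gauge.
have E : (fun m => lorentz q%:E w (first_coordinates m f)) =
    (fun m => weighted_norm q (lorentz_weight q w) (decr (moduli (first_coordinates m f)))).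
  apply/funext => m; rewrite /lorentz /weighted_norm; congr (poweR _ _).
  by apply: eq_eseriesr => n _; rewrite /lorentz_weight mulrA.
by rewrite E.
Qed.

Lemma d1_gaugeyE w : @d1_gauge R k +oo%E w = rearrangement_gauge (weighted_sup w).
Proof. by []. Qed.

End LorentzGauges.

(** * Gauges of indicators, fundamental functions and the quasi-Banach property *)

Section IndicatorGauges.
Variables (R : realType) (k : scalar_kind).
Local Notation F := (scalar_field R k).
Implicit Types (w u : nat -> R) (q : R).

Lemma rearrangement_gauge_indicator Lam (f : nat -> F) (A : {fset nat}) :
  sequence_norm Lam -> (forall j, modulus (f j) = (j \in A)%:R) ->
  rearrangement_gauge Lam f = Lam (fun n => (n < #|` A|)%N%:R).
Proof.
move=> nLam fA; have [m Am] := supported_fset A.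
rewrite (rearrangement_gauge_supported nLam (m := m)).
  by congr Lam; apply/funext => n; exact: decr_indicator.
move=> j mj; apply: modulus_eq0; rewrite fA.
by case: (boolP (j \in A)) => // /Am; rewrite ltnNge mj.
Qed.

Lemma weighted_norm_initial q u m : 0 < q -> weight u ->
  weighted_norm q u (fun n => (n < m)%N%:R) = (primitive u m `^ q^-1)%:E.
Proof.
move=> q0 u0; rewrite (weighted_norm_finite q0 u0 (m := m)); last first.
  by move=> n; rewrite ltnNge => ->.
by congr (_ `^ _)%:E; apply: eq_bigr => i _; rewrite ltn_ord powR1 mul1r.
Qed.

Lemma weighted_sup_initial w m : weight w ->
  weighted_sup w (fun n => (n < m)%N%:R) = (primitive w m)%:E.
Proof.
move=> w0; apply/eqP; rewrite eq_le; apply/andP; split.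
  apply: ge_ereal_sup => _ [n _ <-]; rewrite lee_fin.
  case: ltnP => nm; first by rewrite mul1r primitive_mono.
  by rewrite mul0r primitive_ge0.
case: m => [|m]; last by apply: le_trans (weighted_sup_ge w _ m); rewrite ltnSn mul1r.
by apply: le_trans (weighted_sup_ge w _ 0%N); rewrite ltn0 mul0r primitive0.
Qed.

Lemma d1_gauge_indicator q w (f : nat -> F) (A : {fset nat}) : 0 < q -> weight w ->
  (forall j, modulus (f j) = (j \in A)%:R) ->
  d1_gauge q%:E w f = (primitive (lorentz_weight q w) #|` A| `^ q^-1)%:E.
Proof.
move=> q0 w0 fA; have u0 := lorentz_weight_gt0 q w0.
rewrite d1_gaugeE (rearrangement_gauge_indicator (weighted_norm_sequence_norm q0 u0) fA).
exact: weighted_norm_initial.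
Qed.

Lemma d1_gaugey_indicator w (f : nat -> F) (A : {fset nat}) : weight w ->
  (forall j, modulus (f j) = (j \in A)%:R) ->
  d1_gauge +oo%E w f = (primitive w #|` A|)%:E.
Proof.
move=> w0 fA.
rewrite d1_gaugeyE (rearrangement_gauge_indicator (weighted_sup_sequence_norm w0) fA).
exact: weighted_sup_initial.
Qed.

Definition initial_fset m : {fset nat} := [fset i in iota 0 m]%fset.

Lemma card_initial_fset m : #|` initial_fset m| = m.
Proof. by rewrite card_fseq undup_id ?iota_uniq// size_iota. Qed.

Lemma mem_initial_fset m j : (j \in initial_fset m) = (j < m)%N.
Proof. by rewrite !inE mem_iota. Qed.

Lemma fundamental_d1 q w m : 0 < q -> weight w ->
  fundamental (@d1_gauge R k q%:E w) m = primitive (lorentz_weight q w) m `^ q^-1.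
Proof.
move=> q0 w0; rewrite /fundamental (@d1_gauge_indicator q w _ (initial_fset m))//.
  by rewrite card_initial_fset.
by move=> j; rewrite modulus_nat mem_initial_fset.
Qed.

Lemma fundamental_d1y w m : weight w ->
  fundamental (@d1_gauge R k +oo%E w) m = primitive w m.
Proof.
move=> w0; rewrite /fundamental (@d1_gaugey_indicator w _ (initial_fset m))//.
  by rewrite card_initial_fset.
by move=> j; rewrite modulus_nat mem_initial_fset.
Qed.

(** Part (ii) allows any q > 0. The constant takes the maximum of the two regimes: q^-1 from the
    tangent bound for q <= 1, and 1 from monotonicity for q >= 1. *)
Lemma root_primitive_lorentz_weight_le q w : 0 < q -> weight w -> exists2 K : R, 0 < K &
  forall m, primitive (lorentz_weight q w) m `^ q^-1 <= K * primitive w m.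
Proof.
move=> q0 w0; have q0' : 0 < q^-1 by rewrite invr_gt0.
pose K := Num.max 1 q^-1; have K0 : 0 < K by rewrite lt_max ltr01.
exists (K `^ q^-1); first exact: powR_gt0.
move=> m; have s0 := primitive_ge0 m w0.
rewrite -[X in _ <= _ * X](@powRK _ _ q) ?gt_eqF// -powRM ?powR_ge0 ?(ltW K0)//.
apply: powR_le; [exact: ltW|exact/primitive_ge0/lorentz_weight_gt0|].
have [q1|/ltW q1] := leP q 1.
  apply: le_trans (primitive_lorentz_weight_le _ w0 _) _; first by rewrite q0.
  by rewrite ler_wpM2r ?powR_ge0// le_max lexx orbT.
apply: le_trans (primitive_lorentz_weight_le1 _ w0 q1) _.
by rewrite ler_peMl ?powR_ge0// le_max lexx.
Qed.

Lemma equivalent_fundamental_d1 q w : 0 < q <= 1 -> weight w ->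
  equivalent (fundamental (@d1_gauge R k q%:E w)) (fundamental (@d1_gauge R k +oo%E w)).
Proof.
move=> q01 w0; have /andP[q0 _] := q01.
have [K K0 HK] := root_primitive_lorentz_weight_le q0 w0.
exists (Num.max 1 K) => m _; rewrite fundamental_d1// fundamental_d1y//.
have s0 := primitive_ge0 m w0; split.
  by apply: le_trans (HK m) _; rewrite ler_wpM2r// le_max lexx orbT.
apply: (@le_trans _ _ (primitive (lorentz_weight q w) m `^ q^-1)).
  rewrite -[X in X <= _](@powRK _ _ q) ?gt_eqF//; apply: powR_le.
  - by rewrite invr_ge0 ltW.
  - exact: powR_ge0.
  - exact: primitive_lorentz_weight_ge.
by rewrite ler_peMl ?powR_ge0// le_max lexx.
Qed.

Lemma d1_quasi_banach q w : 0 < q <= 1 -> weight w -> doubling w ->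
  quasi_banach_function_space (@d1_gauge R k q%:E w) /\ symmetric_gauge (@d1_gauge R k q%:E w).
Proof.
move=> q01 w0 wd; have /andP[q0 _] := q01; have u0 := lorentz_weight_gt0 q w0.
have nLam := weighted_norm_sequence_norm q0 u0.
rewrite d1_gaugeE; split; last exact: rearrangement_gauge_symmetric.
apply: rearrangement_gauge_quasi_banach => //.
by apply: weighted_norm_quasi_subadditive => //; exact: lorentz_weight_doubling.
Qed.

Lemma d1y_quasi_banach w : weight w -> doubling w ->
  quasi_banach_function_space (@d1_gauge R k +oo%E w) /\ symmetric_gauge (@d1_gauge R k +oo%E w).
Proof.
move=> w0 wd; have nLam := weighted_sup_sequence_norm w0.
rewrite d1_gaugeyE; split; last exact: rearrangement_gauge_symmetric.
by apply: rearrangement_gauge_quasi_banach => //; exact: weighted_sup_quasi_subadditive.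
Qed.

End IndicatorGauges.

(** * Testing the embeddings on signed indicators; part (ii) *)

Section QuasiNorms.
Variables (R : realType) (k : scalar_kind).
Local Notation F := (scalar_field R k).
Variables (X : lmodType F) (nrm : X -> R).
Hypothesis nrm_quasi : quasi_norm nrm.
Implicit Types (f g : X) (A : {fset nat}) (eps : nat -> F).
Local Open Scope classical_set_scope.

Lemma qnorm_ge0 f : 0 <= nrm f. Proof. by case: nrm_quasi. Qed.

Lemma qnormZ (t : F) f : nrm (t *: f) = modulus t * nrm f. Proof. by case: nrm_quasi. Qed.

Lemma qnorm_eq0 f : nrm f = 0 -> f = 0. Proof. by case: nrm_quasi => _ + _ _; apply. Qed.

Lemma qnorm0 : nrm 0 = 0.
Proof. by rewrite -(scale0r (0 : X)) qnormZ modulus0 mul0r. Qed.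

Lemma qnormN f : nrm (- f) = nrm f.
Proof. by rewrite -scaleN1r qnormZ modulusN1 mul1r. Qed.

Variable xx : nat -> X.

Lemma signed_indicatorE eps A m : (forall j, j \in A -> (j < m)%N) ->
  \sum_(n < m) (if val n \in A then eps n else 0) *: xx n = signed_indicator xx eps A.
Proof.
move=> Am; rewrite /signed_indicator.
rewrite (eq_bigr (fun n : 'I_m => if val n \in A then eps n *: xx n else 0)); last first.
  by move=> n _; case: ifP; rewrite ?scale0r.
rewrite -big_mkcond -(big_mkord (fun n => n \in A) (fun n => eps n *: xx n)).
rewrite -big_filter; apply: perm_big; apply: uniq_perm.
- by rewrite filter_uniq// iota_uniq.
- exact: fset_uniq.
- move=> j; rewrite mem_filter /index_iota subn0 mem_iota /= add0n.
  by case: (boolP (j \in A)) => // /Am ->.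
Qed.

Lemma modulus_sign_indicator eps A j : signs A eps ->
  modulus (if j \in A then eps j else 0) = (j \in A)%:R.
Proof. by move=> epsA; case: ifP => [/epsA ->//|_]; rewrite modulus0. Qed.

Lemma embeds_into_X_signed_indicator q w : 0 < q -> weight w ->
  embeds_into_X nrm xx (d1_space q%:E w) (d1_gauge q%:E w) ->
  exists2 C : R, 0 < C & forall A eps, signs A eps ->
    nrm (signed_indicator xx eps A) <= C * primitive w #|` A|.
Proof.
move=> q0 w0 [C HC]; have [K K0 HK] := root_primitive_lorentz_weight_le q0 w0.
exists (Num.max 1 C * K); first by rewrite mulr_gt0// lt_max ltr01.
move=> A eps epsA; pose a j := if j \in A then eps j else 0.
have aA j : modulus (a j) = (j \in A)%:R := modulus_sign_indicator j epsA.
have [m Am] := supported_fset A.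
have Na := d1_gauge_indicator q0 w0 aA.
have [|g [ag]] := HC a.
  split; last by rewrite Na ltry.
  apply: cvg_near_cst; exists m => // j /= mj; rewrite aA.
  by case: (boolP (j \in A)) => // /Am; rewrite ltnNge mj.
(* The partial sums equal the signed indicator from index m on, so its distance to [g] is the limit
   of an eventually constant sequence and hence 0. *)
have -> : g = signed_indicator xx eps A.
  apply/esym/eqP; rewrite -subr_eq0; apply/eqP/qnorm_eq0.
  apply: (cvg_unique (@Rhausdorff R)) ag => //; apply: cvg_near_cst.
  exists m => // j /= mj; congr (nrm (_ - _)); apply: signed_indicatorE => i /Am im.
  exact: leq_trans im mj.
rewrite Na -EFinM lee_fin => /le_trans; apply.
apply: (@le_trans _ _ (Num.max 1 C * primitive (lorentz_weight q w) #|` A| `^ q^-1)).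
  by rewrite ler_wpM2r ?powR_ge0// le_max lexx orbT.
by rewrite -mulrA ler_wpM2l// le_max ler01.
Qed.

Variable xs : nat -> {scalar X}.
Hypothesis biorthogonal : forall n j, xs n (xx j) = (j == n)%:R.

Lemma xs_signed_indicator eps A n :
  xs n (signed_indicator xx eps A) = if n \in A then eps n else 0.
Proof.
rewrite /signed_indicator linear_sum/=.
under eq_bigr => j _ do rewrite linearZ/= biorthogonal.
case: ifP => nA.
  rewrite (big_fsetD1 n)//= eqxx mulr1 big1_fset ?addr0// => j.
  by rewrite !inE => /andP[/negbTE ->]; rewrite mulr0.
by rewrite big1_fset// => j jA _; case: eqP jA => [->|]; rewrite ?nA// mulr0.
Qed.

Lemma X_embeds_into_signed_indicator w : weight w ->
  X_embeds_into nrm xs (d1_gauge +oo%E w) ->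
  exists2 C : R, 0 < C & forall A eps, signs A eps ->
    primitive w #|` A| <= C * nrm (signed_indicator xx eps A).
Proof.
move=> w0 [C HC]; exists (Num.max 1 C); first by rewrite lt_max ltr01.
move=> A eps epsA; have := HC (signed_indicator xx eps A).
rewrite (@d1_gaugey_indicator R k w _ A)//; last first.
  by move=> j; rewrite xs_signed_indicator; exact: modulus_sign_indicator.
rewrite lee_fin => /le_trans; apply.
by rewrite ler_wpM2r ?qnorm_ge0// le_max lexx orbT.
Qed.

Lemma phi_u_le m (C : R) :
  (forall A eps, (#|` A| <= m)%N -> signs A eps -> nrm (signed_indicator xx eps A) <= C) ->
  phi_u nrm xx m <= C.
Proof.
move=> H; apply: ge_sup => [|_ [A [eps [Am epsA ->]]]]; last exact: H.
by eexists; exists fset0, (fun=> 1); split=> //; rewrite /signs => n; rewrite inE.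
Qed.

(** The bound [C] ensures that the real-valued [sup] is a genuine supremum and not a default
    value. *)
Lemma phi_u_ge m (C : R) A eps :
  (forall A eps, (#|` A| <= m)%N -> signs A eps -> nrm (signed_indicator xx eps A) <= C) ->
  (#|` A| <= m)%N -> signs A eps -> nrm (signed_indicator xx eps A) <= phi_u nrm xx m.
Proof.
move=> H Am epsA; apply: ub_le_sup; last by exists A, eps.
by exists C => _ [B [del [Bm delB ->]]]; exact: H.
Qed.

Lemma phi_l_ge m (c : R) :
  (forall A eps, (m <= #|` A|)%N -> signs A eps -> c <= nrm (signed_indicator xx eps A)) ->
  c <= phi_l nrm xx m.
Proof.
move=> H; apply: lb_le_inf => [|_ [A [eps [Am epsA ->]]]]; last exact: H.
eexists; exists (initial_fset m), (fun=> 1); split=> //; first by rewrite card_initial_fset.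
by move=> n _; exact: modulus1.
Qed.

Lemma phi_l_le m A eps : (m <= #|` A|)%N -> signs A eps ->
  phi_l nrm xx m <= nrm (signed_indicator xx eps A).
Proof.
move=> Am epsA; apply: ge_inf; last by exists A, eps.
by exists 0 => _ [B [del [_ _ ->]]]; exact: qnorm_ge0.
Qed.

(** The embeddings give s <= D phi_l and phi_u <= C s. A set with exactly m elements competes in
    both extrema, so phi_l <= phi_u closes the circle. *)
Lemma lorentz_sandwich_equivalent q w : 0 < q -> weight w ->
  lorentz_sandwich nrm xx xs q w ->
  equivalent (phi_l nrm xx) (primitive w) /\ equivalent (primitive w) (phi_u nrm xx).
Proof.
move=> q0 w0 [embX Xemb].
have [C C0 HC] := embeds_into_X_signed_indicator q0 w0 embX.
have [D D0 HD] := X_embeds_into_signed_indicator w0 Xemb.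
have ones A : signs A (fun=> 1 : F) by move=> n _; exact: modulus1.
have ub m A eps : (#|` A| <= m)%N -> signs A eps ->
    nrm (signed_indicator xx eps A) <= C * primitive w m.
  by move=> Am epsA; apply: le_trans (HC _ _ epsA) _; rewrite ler_pM2l// primitive_mono.
have lb m A eps : (m <= #|` A|)%N -> signs A eps ->
    D^-1 * primitive w m <= nrm (signed_indicator xx eps A).
  move=> Am epsA; rewrite ler_pdivrMl//; apply: le_trans (HD _ _ epsA).
  exact: primitive_mono.
have l_ge m : primitive w m <= D * phi_l nrm xx m.
  by rewrite -ler_pdivrMl//; apply: phi_l_ge; exact: lb.
have u_le m : phi_u nrm xx m <= C * primitive w m by apply: phi_u_le; exact: ub.
have lu m : phi_l nrm xx m <= phi_u nrm xx m.
  apply: (@le_trans _ _ (nrm (signed_indicator xx (fun=> 1) (initial_fset m)))).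
    by apply: phi_l_le => //; rewrite card_initial_fset.
  by apply: (phi_u_ge (@ub m)) => //; rewrite card_initial_fset.
have s0 m := primitive_ge0 m w0.
have l0 m : 0 <= phi_l nrm xx m by rewrite -(pmulr_rge0 _ D0); exact: le_trans (s0 m) (l_ge m).
have u0 m : 0 <= phi_u nrm xx m := le_trans (l0 m) (lu m).
split; exists (Num.max C D) => m _; split.
- apply: le_trans (le_trans (lu m) (u_le m)) _.
  by rewrite ler_wpM2r// le_max lexx.
- by apply: le_trans (l_ge m) _; rewrite ler_wpM2r// le_max lexx orbT.
- apply: le_trans (l_ge m) _; apply: ler_pM => //; first exact: ltW.
  by rewrite le_max lexx orbT.
- by apply: le_trans (u_le m) _; rewrite ler_wpM2r// le_max lexx.
Qed.

End QuasiNorms.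

(** * Coefficients, greedy sets, doubling, and the embedding of X *)

Section Bases.
Variables (R : realType) (k : scalar_kind).
Local Notation F := (scalar_field R k).
Variables (X : lmodType F) (nrm : X -> R).
Hypothesis nrm_quasi : quasi_norm nrm.
Variables (xx : nat -> X) (xs : nat -> {scalar X}).
Implicit Types (f g : X) (A : {fset nat}) (eps : nat -> F) (w : nat -> R).
Local Open Scope classical_set_scope.

Lemma qnorm_normalize f : exists2 g, nrm g <= 1 & f = of_real k (nrm f) *: g.
Proof.
have [/(qnorm_eq0 nrm_quasi) ->|f0] := eqVneq (nrm f) 0.
  by exists 0; rewrite ?scaler0 ?(qnorm0 nrm_quasi)// ler01.
exists (of_real k (nrm f)^-1 *: f).
  rewrite (qnormZ nrm_quasi) modulus_of_real ger0_norm ?invr_ge0 ?(qnorm_ge0 nrm_quasi)//.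
  by rewrite mulVf.
by rewrite scalerA -of_realM mulfV// (_ : of_real k 1 = 1) ?scale1r//; case: (k).
Qed.

Lemma le_dual_norm (phi : {scalar X}) f : continuous_functional nrm phi ->
  modulus (phi f : F) <= dual_norm nrm phi * nrm f.
Proof.
move=> cphi; have [g g1 fg] := qnorm_normalize f.
rewrite {1}fg linearZ/= modulusM modulus_of_real ger0_norm ?(qnorm_ge0 nrm_quasi)// mulrC.
rewrite ler_wpM2r ?(qnorm_ge0 nrm_quasi)//; apply: ub_le_sup; last by exists g.
(* Continuity at 0 bounds the functional by 2 / d on the unit ball, so the [sup] in [dual_norm] is
   genuine. Scaling by d / 2 meets the strict inequality in the definition of continuity. *)
have [d d0 Hd] := cphi 0 1 ltr01; exists (2 / d) => _ [h /= h1 <-].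
have := Hd (of_real k (d / 2) *: h).
rewrite subr0 linear0 subr0 (qnormZ nrm_quasi) linearZ/= modulusM modulus_of_real.
have d2 : 0 <= d / 2 by rewrite divr_ge0// ltW.
rewrite ger0_norm// => H.
have /H/ltW : d / 2 * nrm h < d.
  by have := qnorm_ge0 nrm_quasi h; nra.
by rewrite -ler_pdivlMl ?divr_gt0// mulr1 invf_div.
Qed.

Hypothesis xx_basis : is_basis nrm xx xs.
Hypothesis xx_M_bounded : M_bounded nrm xx xs.
Hypothesis xx_semi_normalized : semi_normalized nrm xx.

(** Dividing the M-bound by the lower bound c for the norms of the basis vectors bounds all dual
    norms by c^-1 C. *)
Lemma basis_coef_bounded : exists2 B : R, 0 < B & forall n f, modulus (xs n f : F) <= B * nrm f.
Proof.
have [_ xs_cont _] := xx_basis.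
have [C HC] := xx_M_bounded; have [c [c' [c0 Hc]]] := xx_semi_normalized.
exists (Num.max 1 (c^-1 * C)); first by rewrite lt_max ltr01.
move=> n f; apply: le_trans (le_dual_norm f (xs_cont n)) _.
rewrite ler_wpM2r ?(qnorm_ge0 nrm_quasi)// le_max; apply/orP; right.
rewrite ler_pdivlMl//; apply: le_trans (HC n); rewrite ler_wpM2r//.
  have := le_dual_norm (xx n) (xs_cont n); have := modulus_ge0 (xs n (xx n) : F).
  have /andP[cx _] := Hc n; have x0 : 0 < nrm (xx n) by exact: lt_le_trans cx.
  by move=> m0 /(le_trans m0); rewrite pmulr_lge0.
by have /andP[] := Hc n.
Qed.

(** Beyond the support of a finite combination close to [f], the coefficients of [f] are those of
    the error, hence uniformly small. *)
Lemma basis_coef_c0 f : c0 (fun n => xs n f : F).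
Proof.
have [dense _ bio] := xx_basis; have [B B0 HB] := basis_coef_bounded.
apply/cvgr0Pnorm_lt => e e0.
have [m [c Hc]] := dense f (e / B) (divr_gt0 e0 B0).
exists m => // n /= mn; rewrite ger0_norm ?modulus_ge0//.
have -> : xs n f = xs n (f - \sum_(i < m) c i *: xx i).
  rewrite linearB/= linear_sum/= big1 ?subr0// => i _.
  rewrite linearZ/= bio; case: eqP => [ein|]; last by rewrite mulr0.
  by have := ltn_ord i; rewrite ein ltnNge mn.
by apply: le_lt_trans (HB _ _) _; rewrite mulrC -ltr_pdivlMr.
Qed.

Lemma fresh_index A : exists j, j \notin A.
Proof.
have [m Am] := supported_fset A; exists m.
by apply/negP => /Am; rewrite ltnn.
Qed.

(** Either the first candidate is already maximal, or some [b j1] exceeds it and is positive; then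
    only finitely many indices reach the level [b j1]. Among the maximisers the least index is
    taken, as the tie-breaking rule of greedy sets demands. *)
Lemma c0_argmax (b : nat -> R) A : (forall n, 0 <= b n) -> b @ \oo --> (0 : R) ->
  exists2 n, n \notin A & forall j, j \notin A -> b j < b n \/ (b n = b j /\ (n <= j)%N).
Proof.
move=> b0 bcvg.
have [n1 n1A Hn1] : exists2 n, n \notin A & forall j, j \notin A -> b j <= b n.
  have [j0 j0A] := fresh_index A.
  have [|/existsNP[j1 /not_implyP[j1A /negP]]] := pselect (forall j, j \notin A -> b j <= b j0).
    by exists j0.
  rewrite -ltNge => bj1; have bj1_gt0 : 0 < b j1 := le_lt_trans (b0 j0) bj1.
  have [N _ HN] := cvgr_lt _ bcvg _ bj1_gt0.
  have j1N : (j1 < N)%N by rewrite ltnNge; apply/negP => /HN/=; rewrite ltxx.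
  have [i iA Hi] := @Order.TotalTheory.arg_maxP _ _ _ (Ordinal j1N)
    (fun i : 'I_N => val i \notin A) (fun i => b (val i)) j1A.
  exists (val i) => // j jA; have [jN|Nj] := ltnP j N; first exact: (Hi (Ordinal jN)).
  by apply: le_trans (Hi (Ordinal j1N) j1A); exact/ltW/HN.
have exP : exists n, (n \notin A) && (b n == b n1) by exists n1; rewrite n1A eqxx.
case: (ex_minnP exP) => n /andP[nA /eqP bn] nmin.
exists n => // j jA; rewrite bn; have := Hn1 _ jA; rewrite le_eqVlt => /predU1P[bj|]; last by left.
by right; split=> //; apply: nmin; rewrite jA bj eqxx.
Qed.

(** [xget] meets its specification once a greedy set exists; one of size m + 1 arises by adjoining
    the best remaining index to one of size m. *)
Lemma greedy_setP f m : is_greedy_set xs f m (greedy_set xs f m).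
Proof.
apply: (@xgetPex _ fset0 [set A | is_greedy_set xs f m A]).
elim: m => [|m [A [Am HA]]]; first by exists fset0; split.
have b0 n := modulus_ge0 (xs n f : F).
have [n nA Hn] := c0_argmax A b0 (basis_coef_c0 f).
exists (n |` A)%fset; split; first by rewrite cardfsU1 nA Am.
move=> i j; rewrite !inE negb_or => iA /andP[jn jA].
case/orP: iA => [/eqP ->|iA]; last exact: HA.
have [|[-> nj]] := Hn _ jA; first by left.
by right; split=> //; rewrite ltn_neqAle eq_sym jn nj.
Qed.

Hypothesis xx_democratic : super_democratic nrm xx.

Lemma ones_signs A : signs A (fun=> 1 : F).
Proof. by move=> n _; exact: modulus1. Qed.

Lemma signed_indicator_bounded m : exists C : R, forall A eps, (#|` A| <= m)%N ->
  signs A eps -> nrm (signed_indicator xx eps A) <= C.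
Proof.
have [C HC] := xx_democratic.
exists (C * nrm (signed_indicator xx (fun=> 1) (initial_fset m))) => A eps Am epsA.
by apply: HC => //; [rewrite card_initial_fset|exact: ones_signs].
Qed.

Lemma le_phi_u m A eps : (#|` A| <= m)%N -> signs A eps ->
  nrm (signed_indicator xx eps A) <= phi_u nrm xx m.
Proof. by have [C HC] := signed_indicator_bounded m; exact: phi_u_ge HC. Qed.

Lemma phi_u_ge0 m : 0 <= phi_u nrm xx m.
Proof.
apply: le_trans (@le_phi_u m fset0 (fun=> 1) _ _) => //; exact: qnorm_ge0.
Qed.

Lemma phi_u_democratic : exists2 C : R, 0 < C & forall A eps, signs A eps ->
  phi_u nrm xx #|` A| <= C * nrm (signed_indicator xx eps A).
Proof.
have [C HC] := xx_democratic; exists (Num.max 1 C); first by rewrite lt_max ltr01.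
move=> A eps epsA; apply: phi_u_le => B del BA delB; apply: le_trans (HC _ _ _ _ BA delB epsA) _.
by rewrite ler_wpM2r ?(qnorm_ge0 nrm_quasi)// le_max lexx orbT.
Qed.

Lemma equivalent_pos (alpha beta : nat -> R) : equivalent alpha beta ->
  (forall m, 0 <= alpha m) -> (forall m, 0 <= beta m) ->
  exists2 C : R, 0 < C & forall m, (0 < m)%N -> alpha m <= C * beta m /\ beta m <= C * alpha m.
Proof.
move=> [C HC] a0 b0; exists (Num.max 1 C); first by rewrite lt_max ltr01.
by move=> m /HC[ab ba]; split; [apply: le_trans ab _|apply: le_trans ba _];
  rewrite ler_wpM2r// le_max lexx orbT.
Qed.

Lemma signed_indicator_seq eps (s : seq nat) : uniq s ->
  signed_indicator xx eps [fset n in s]%fset = \sum_(n <- s) eps n *: xx n.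
Proof.
move=> us; apply: perm_big; apply: uniq_perm => //.
by move=> n; rewrite !inE.
Qed.

Lemma phi_u_double : exists2 K : R, 0 < K &
  forall m, phi_u nrm xx m.*2 <= K * phi_u nrm xx m.
Proof.
have [_ _ _ [kappa [kappa1 nrmD]]] := nrm_quasi.
have kappa0 : 0 < kappa by exact: lt_le_trans kappa1.
exists (kappa * 2); first by rewrite mulr_gt0.
move=> m; apply: phi_u_le => A eps Am epsA.
have le_seq s : uniq s -> {subset s <= A} -> (size s <= m)%N ->
    nrm (\sum_(n <- s) eps n *: xx n) <= phi_u nrm xx m.
  move=> us sA sm; rewrite -signed_indicator_seq//; apply: le_phi_u.
    by rewrite card_fseq undup_id.
  by move=> n; rewrite inE => /sA/epsA.
have uA := fset_uniq A.
rewrite /signed_indicator -[enum_fset A](cat_take_drop m) big_cat/=.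
apply: le_trans (nrmD _ _) _; rewrite -mulrA ler_wpM2l ?(ltW kappa0)// mulr_natl mulr2n.
apply: lerD; apply: le_seq.
- exact: take_uniq.
- by move=> n /mem_take.
- by rewrite size_take_min geq_minl.
- exact: drop_uniq.
- by move=> n /mem_drop.
- by rewrite size_drop; move: Am; rewrite -addnn leq_subLR.
Qed.

Lemma doubling_of_phi_u w : weight w -> equivalent (primitive w) (phi_u nrm xx) -> doubling w.
Proof.
move=> w0 /equivalent_pos[m|m|C C0 HC]; [exact: primitive_ge0|exact: phi_u_ge0|].
(* [equivalent] says nothing at cardinality 0, where both primitives vanish; elsewhere the doubling
   constant of [phi_u] is conjugated by the equivalence. *)
have [K K0 HK] := phi_u_double; exists (C * (K * C)) => -[|m]; first by rewrite primitive0 mulr0.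
have [ab _] := HC m.+1.*2 isT; have [_ ba] := HC m.+1 isT.
apply: le_trans ab _; rewrite -mulrA ler_pM2l//; apply: le_trans (HK _) _.
by rewrite -mulrA ler_pM2l.
Qed.

(** Deleting i from the greedy set of size n + 1 leaves n exceptional indices, and every other
    coefficient has modulus at most that of i. The 0-based index n of the rearrangement thus matches
    the operator of order n + 1. *)
Lemma decr_le_greedy f n M i : i \in greedy_set xs f n.+1 ->
  decr (moduli (first_coordinates M (fun n => xs n f : F))) n <= modulus (xs i f : F).
Proof.
have [cardA HA] := greedy_setP f n.+1; move=> iA.
apply: (@decr_le _ _ _ (greedy_set xs f n.+1 `\ i)%fset); first exact: modulus_ge0.
  by have := cardfsD1 i (greedy_set xs f n.+1); rewrite iA cardA add1n => -[<-].
move=> j; rewrite moduli_first !inE negb_and negbK => jA.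
case: ifP => _; last exact: modulus_ge0.
case/orP: jA => [/eqP -> //|jA].
by have [/ltW//|[-> _]] := HA _ _ iA jA.
Qed.

Lemma truncation_bounded_X_embeds_into w : weight w ->
  equivalent (primitive w) (phi_u nrm xx) -> truncation_bounded nrm xx xs ->
  X_embeds_into nrm xs (d1_gauge +oo%E w).
Proof.
move=> w0 /equivalent_pos[m|m|C C0 HC [U HU]]; [exact: primitive_ge0|exact: phi_u_ge0|].
have [D D0 HD] := phi_u_democratic.
(* [C] compares the primitive weight with [phi_u], [D] comes from super-democracy and [U] bounds the
   truncations. As [U] refers to the unit ball, f is normalised and homogeneity restores its
   norm. *)
exists (C * D * U) => f; have [g g1 fg] := qnorm_normalize f.
have nf0 : 0 <= nrm f := qnorm_ge0 nrm_quasi f.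
rewrite d1_gaugeyE.
have -> : (fun n => xs n f) = (fun n => of_real k (nrm f) * (xs n g : F)).
  by apply/funext => n; rewrite {1}fg linearZ.
rewrite (rearrangement_gaugeZ (weighted_sup_sequence_norm w0)) modulus_of_real.
rewrite ger0_norm// mulrC EFinM lee_wpmul2l ?lee_fin//.
apply: ge_ereal_sup => _ [M _ <-]; apply: ge_ereal_sup => _ [n _ <-]; rewrite lee_fin.
have [cardA HA] := greedy_setP g n.+1; set A := greedy_set xs g n.+1 in cardA HA *.
pose eps j := sign (xs j g : F); pose al := inf [set modulus (xs i g : F) | i in [set` A]].
have epsA : signs A eps by move=> j _; exact: modulus_sign.
have A0 : exists i, i \in A by apply/fset0Pn; rewrite -cardfs_gt0 cardA.
have le_al : decr (moduli (first_coordinates M (fun n => xs n g : F))) n <= al.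
  apply: lb_le_inf; first by have [i iA] := A0; exists (modulus (xs i g : F)); exists i.
  by move=> _ [i /= iA <-]; exact: decr_le_greedy.
have al0 : 0 <= al := le_trans (decr_ge0 _ _) le_al.
have UA : al * nrm (signed_indicator xx eps A) <= U.
  have := HU n.+1 g g1; rewrite /restricted_truncation (qnormZ nrm_quasi) modulus_of_real.
  by rewrite ger0_norm.
apply: (@le_trans _ _ (al * (C * (D * nrm (signed_indicator xx eps A))))); last first.
  by rewrite -mulrA mulrCA ler_pM2l// mulrCA ler_pM2l.
apply: ler_pM => //; [exact: decr_ge0|exact: primitive_ge0|].
have [sn _] := HC n.+1 isT; apply: le_trans sn _; rewrite ler_pM2l// -cardA.
exact: HD.
Qed.

End Bases.

(** * Binary digits relative to a maximum *)

Section BinaryExpansion.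
Variable R : realType.
Implicit Types (x y M p : R).

(** Digit 0 is worth M / 2, so x = M is included: all its digits are 1. *)
Definition binary_unit M k : R := M / 2 ^+ k.+1.

(* What is left of [x] in [0, M] after its first [k] binary digits relative to
   the unit [M]; the [k]-th digit is 1 iff
   [binary_unit M k <= binary_rest M k x]. *)
Fixpoint binary_rest M k x : R :=
  if k is k'.+1 then
    let y := binary_rest M k' x in
    if binary_unit M k' <= y then y - binary_unit M k' else y
  else x.

Lemma binary_rest_bounds M k x : 0 <= x <= M -> 0 <= binary_rest M k x <= M / 2 ^+ k.
Proof.
move=> /andP[x0 xM]; elim: k => [|k /andP[y0 yM]]/=; first by rewrite expr0 divr1 x0.
have E : M / 2 ^+ k = binary_unit M k + binary_unit M k.
  by rewrite /binary_unit exprS; field; rewrite expf_neq0.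
move: yM; rewrite E -/(binary_unit M k) => yM.
by case: ifPn => [h|]; rewrite ?subr_ge0 ?h ?lerBlDr// -ltNge => /ltW ->; rewrite y0.
Qed.

(** Consequently digit k of [x] can be 1 only if [binary_unit M k <= x]. *)
Lemma binary_rest_le M k x : 0 <= M -> binary_rest M k x <= x.
Proof.
move=> M0; elim: k => [|k IH]//=; case: ifP => // _; apply: le_trans IH.
by rewrite lerBlDr lerDl divr_ge0// exprn_ge0.
Qed.

Lemma sum_binary_unit_powR p M y K : 0 < p -> 0 <= M -> 0 <= y ->
  \sum_(k < K) (if binary_unit M k <= y then binary_unit M k `^ p else 0) <=
  (1 - 2^-1 `^ p)^-1 * y `^ p.
Proof.
move=> p0 M0 y0; set r := 2^-1 `^ p; set G := (1 - r)^-1.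
have r1 : r < 1.
  have := @gt0_ltr_powR R p p0 2^-1 1; rewrite powR1; apply; rewrite ?nnegrE ?invr_ge0//.
  by rewrite invf_lt1// ltr1n.
have G0 : 0 < G by rewrite invr_gt0 subr_gt0.
have Gr : 1 + G * r = G by rewrite /G; field; rewrite subr_eq0 gt_eqF.
(* The minimum strengthens the bound for induction: dropping the first digit replaces M by M / 2. If
   the first unit counts, the step closes by the geometric identity 1 + G r = G. *)
apply: (@le_trans _ _ (G * Num.min y (M / 2) `^ p)); last first.
  by rewrite ler_pM2l// powR_le ?(ltW p0)// ?le_min ?y0 ?divr_ge0// ge_min lexx.
elim: K M M0 => [|K IH] M M0; first by rewrite big_ord0 mulr_ge0 ?powR_ge0 ?ltW.
rewrite big_ord_recl.
have E k : binary_unit M k.+1 = binary_unit (M / 2) k.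
  by rewrite /binary_unit [in LHS]exprS; field; rewrite expf_neq0.
rewrite (eq_bigr (fun k : 'I_K =>
    if binary_unit (M / 2) k <= y then binary_unit (M / 2) k `^ p else 0)); last first.
  by move=> k _; rewrite lift0 E.
have M2 : 0 <= M / 2 by rewrite divr_ge0.
have {IH} := IH _ M2; set S := \sum_(k < K) _ => HS.
rewrite {1 2}/binary_unit expr1.
case: ifPn => [My|].
  rewrite min_r//; apply: le_trans (_ : (M / 2) `^ p + G * (M / 2 / 2) `^ p <= _).
    rewrite lerD2l; apply: le_trans HS _; rewrite ler_pM2l//.
    by apply: powR_le; rewrite ?(ltW p0) ?le_min ?y0 ?divr_ge0 ?ge_min ?lexx ?orbT.
  rewrite [(M / 2 / 2) `^ p]powRM ?invr_ge0// -/r -[X in _ <= X * _]Gr.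
  by rewrite mulrDl mul1r lerD2l -mulrA [r * _]mulrC.
rewrite -ltNge => yM; rewrite add0r; apply: le_trans HS _; rewrite ler_pM2l//.
apply: powR_le; [exact: ltW|by rewrite le_min y0 !divr_ge0|].
by rewrite le_min !ge_min lexx/= (ltW yM).
Qed.

Lemma exists_expr2_ge x y : 0 < y -> exists K, x / 2 ^+ K <= y.
Proof.
move=> y0; have [K xK] : exists K : nat, x / y < K%:R.
  exists (Num.bound `|x / y|); apply: le_lt_trans (ler_norm _) _; exact: archi_boundP.
exists K; rewrite ler_pdivrMr ?exprn_gt0// mulrC -ler_pdivrMr//.
apply: le_trans (ltW xK) _; rewrite -natrX ler_nat; exact/ltnW/ltn_expl.
Qed.

End BinaryExpansion.

(** * Embedding of the Lorentz space into X *)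

Section Embedding.
Variables (R : realType) (k : scalar_kind).
Local Notation F := (scalar_field R k).
Variables (X : lmodType F) (nrm : X -> R).
Hypothesis nrm_quasi : quasi_norm nrm.
Variable p : R.
Hypothesis p01 : 0 < p <= 1.
Hypothesis nrm_p_convex : p_convex nrm p.
Variable (xx : nat -> X).
Implicit Types (f g : X) (A : {fset nat}) (eps a : nat -> F) (w : nat -> R).
Local Open Scope classical_set_scope.

Let p0 : 0 < p. Proof. by case/andP: p01. Qed.
Let p'0 : 0 <= p^-1. Proof. by rewrite invr_ge0 ltW. Qed.

Lemma p_convex_le : exists2 C : R, 0 < C & forall (n : nat) (f : 'I_n -> X) (c : 'I_n -> R),
  (forall i, nrm (f i) <= c i) -> nrm (\sum_(j < n) f j) <= C * (\sum_(j < n) c j `^ p) `^ p^-1.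
Proof.
have [C HC] := nrm_p_convex; exists (Num.max 1 C); first by rewrite lt_max ltr01.
move=> n f c fc; apply: le_trans (HC n f) _.
apply: (@le_trans _ _ (Num.max 1 C * (\sum_(j < n) nrm (f j) `^ p) `^ p^-1)).
  by rewrite ler_wpM2r ?powR_ge0// le_max lexx orbT.
rewrite ler_wpM2l//; first by rewrite le_max ler01.
apply: powR_le => //; first by apply: sumr_ge0 => i _; exact: powR_ge0.
apply: ler_sum => i _; apply: powR_le => //; [exact: ltW|exact: qnorm_ge0].
Qed.

Variables (w : nat -> R) (B : R).
Hypothesis w_weight : weight w.
Hypothesis B_gt0 : 0 < B.
Hypothesis signed_indicator_le : forall A eps, signs A eps ->
  nrm (signed_indicator xx eps A) <= B * primitive w #|` A|.
Local Notation u := (lorentz_weight p w).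

(** The p-th power of the gauge in d_(1,p)(w) when [a] is supported in the first m coordinates. *)
Definition lorentz_sum m a : R := \sum_(n < m) decr (moduli a) n `^ p * u n.

(** Each digit layer shares one coefficient, so with the signs kept apart it is a multiple of a
    signed indicator; the expansion stops after K digits with an explicit remainder. *)
Lemma sum_binary_expansion m (M : R) (b : nat -> R) eps K : 0 <= M ->
  \sum_(n < m) (of_real k (b n) * eps n) *: xx n =
  \sum_(i < K) of_real k (binary_unit M i) *: signed_indicator xx eps
     [fset n in iota 0 m | binary_unit M i <= binary_rest M i (b n)]%fset +
  \sum_(n < m) (of_real k (binary_rest M K (b n)) * eps n) *: xx n.
Proof.
move=> M0; elim: K => [|K ->]; first by rewrite big_ord0 add0r.
rewrite big_ord_recr/= -addrA; congr (_ + _).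
rewrite -(@signed_indicatorE _ _ _ xx eps _ m); last first.
  by move=> j; rewrite !inE mem_iota => /andP[].
rewrite scaler_sumr -big_split/=; apply: eq_bigr => n _.
rewrite scalerA -scalerDl; congr (_ *: _); rewrite !inE mem_iota/= add0n ltn_ord/=.
case: ifP => _; last by rewrite mulr0 add0r.
by rewrite -mulrDl -of_realD addrC subrK.
Qed.

Lemma moduli_le_decr0 m a j : supported m a -> moduli a j <= decr (moduli a) 0.
Proof.
move=> am; apply: (@decr_ge _ _ _ [fset j]%fset); first exact: bounded_moduli am.
  by rewrite cardfs1.
by move=> i; rewrite inE => /eqP ->.
Qed.

Lemma lorentz_sum_ge0 m a : 0 <= lorentz_sum m a.
Proof.
by apply: sumr_ge0 => i _; rewrite mulr_ge0 ?powR_ge0// ltW// lorentz_weight_gt0.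
Qed.

(** The first summand alone gives this; it serves to absorb the remainder of the binary
    expansion. *)
Lemma decr0_le_lorentz_sum m a : (0 < m)%N ->
  decr (moduli a) 0 * primitive w 1 <= lorentz_sum m a `^ p^-1.
Proof.
case: m => // m _.
rewrite -[X in X <= _](@powRK _ _ p) ?gt_eqF ?mulr_ge0 ?decr_ge0 ?primitive_ge0//.
apply: powR_le => //; first exact: powR_ge0.
rewrite powRM ?decr_ge0 ?primitive_ge0// /lorentz_sum big_ord_recl.
apply: (@le_trans _ _ (decr (moduli a) 0 `^ p * u 0%N)); last first.
  rewrite lerDl; apply: sumr_ge0 => i _.
  by rewrite mulr_ge0 ?powR_ge0// ltW// lorentz_weight_gt0.
rewrite ler_wpM2l ?powR_ge0//.
have := primitive_lorentz_weight_ge 1 w_weight p01.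
by rewrite [X in _ <= X]primitiveS primitive0 add0r.
Qed.

(* A set of indices at which [moduli a] is at least h has cardinality N with
   [decr (moduli a) n >= h] for all n < N, so the powers
   [primitive w N `^ p <= primitive u N] can be summed index by index, each index
   contributing a geometric sum. *)
Lemma sum_digits_le m a K (M := decr (moduli a) 0) : supported m a ->
  \sum_(i < K) (binary_unit M i * (B * primitive w
     #|` [fset n in iota 0 m | binary_unit M i <= binary_rest M i (moduli a n)]%fset|)) `^ p
  <= B `^ p * ((1 - 2^-1 `^ p)^-1 * lorentz_sum m a).
Proof.
move=> am; have M0 : 0 <= M by exact: decr_ge0.
have h0 i : 0 <= binary_unit M i by rewrite divr_ge0// exprn_ge0.
apply: (@le_trans _ _ (\sum_(i < K) B `^ p * \sum_(n < m)
    (if binary_unit M i <= decr (moduli a) n then binary_unit M i `^ p else 0) * u n)); last first.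
  rewrite -mulr_sumr ler_wpM2l ?powR_ge0// exchange_big/= /lorentz_sum mulr_sumr.
  apply: ler_sum => n _.
  rewrite -mulr_suml [X in _ <= X]mulrA; apply: ler_wpM2r; first by rewrite ltW// lorentz_weight_gt0.
  by apply: sum_binary_unit_powR => //; exact: decr_ge0.
apply: ler_sum => i _; set A := [fset _ in _ | _]%fset.
rewrite mulrCA (@powRM _ B) ?mulr_ge0 ?primitive_ge0 ?(ltW B_gt0)//.
rewrite (@powRM _ (binary_unit M i)) ?primitive_ge0//.
rewrite ler_wpM2l ?powR_ge0//.
apply: (@le_trans _ _ (binary_unit M i `^ p * primitive u #|` A|)).
  by rewrite ler_wpM2l ?powR_ge0//; exact: primitive_lorentz_weight_ge.
have Am : (#|` A| <= m)%N.
  rewrite -[leqRHS]card_initial_fset; apply: fsubset_leq_card; apply/fsubsetP => n.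
  by rewrite !inE => /andP[].
rewrite /primitive (big_ord_widen _ u Am) big_mkcond mulr_sumr; apply: ler_sum => n _.
have u0 := ltW (lorentz_weight_gt0 p w_weight n).
case: ifP => nA; last by rewrite mulr0 mulr_ge0//; case: ifP => //; rewrite powR_ge0.
rewrite ifT//; apply: (decr_ge (bounded_moduli am) nA) => j; rewrite !inE => /andP[_ hj].
by apply: le_trans hj _; exact: binary_rest_le.
Qed.

Lemma lorentz_sum_bound : exists2 D : R, 0 < D & forall m a, supported m a ->
  nrm (\sum_(n < m) a n *: xx n) <= D * lorentz_sum m a `^ p^-1.
Proof.
have [C C0 HC] := p_convex_le.
have [_ _ _ [kappa [kappa1 nrmD]]] := nrm_quasi.
have kappa0 : 0 < kappa by exact: lt_le_trans kappa1.
pose G := (1 - 2^-1 `^ p)^-1 : R.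
(* [kappa] separates the digit layers from the remainder; the first summand bounds the layers, the
   second the remainder. *)
exists (kappa * (C * (B * G `^ p^-1) + C)).
  by rewrite mulr_gt0// ltr_wpDl// mulr_ge0 ?(ltW C0)// mulr_ge0 ?powR_ge0// ltW.
move=> [|m'] a am.
  rewrite big_ord0 (qnorm0 nrm_quasi) mulr_ge0 ?powR_ge0// mulr_ge0 ?(ltW kappa0)//.
  by rewrite addr_ge0 ?(ltW C0)// mulr_ge0 ?(ltW C0)// mulr_ge0 ?powR_ge0// ltW.
set m := m'.+1 in am *.
set M := decr (moduli a) 0; have M0 : 0 <= M by exact: decr_ge0.
have G0 : 0 <= G.
  (* With M = y = 1 and one digit, the geometric bound says that [G] dominates a nonnegative sum. *)
  have := @sum_binary_unit_powR R p 1 1 1 p0 ler01 ler01.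
  rewrite powR1 mulr1; apply: le_trans; apply: sumr_ge0 => i _.
  by case: ifP => // _; exact: powR_ge0.
pose eps n := sign (a n).
(* The remainder has m terms with coefficients at most M / 2^K, so p-convexity costs a factor
   m^(1/p). This K outweighs it, which keeps the final constant independent of m. *)
have [K HK] := exists_expr2_ge (B * m%:R `^ p^-1) (@ltr01 R).
have -> : \sum_(n < m) a n *: xx n =
    \sum_(n < m) (of_real k (moduli a n) * eps n) *: xx n.
  by apply: eq_bigr => n _; rewrite /eps of_real_sign.
rewrite (sum_binary_expansion m (moduli a) eps K M0).
set P := \sum_(i < K) _; set Q := \sum_(n < m) _.
apply: le_trans (nrmD P Q) _; rewrite -mulrA ler_pM2l// mulrDl; apply: lerD.
  apply: le_trans (HC _ _ _ _) _.
    move=> i; rewrite (qnormZ nrm_quasi) modulus_of_real ger0_norm; last first.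
      by rewrite divr_ge0// exprn_ge0.
    apply: ler_wpM2l; first by rewrite divr_ge0// exprn_ge0.
    by apply: signed_indicator_le => n _; exact: modulus_sign.
  rewrite -mulrA ler_pM2l//.
  rewrite -[X in X * _ * _](@powRK _ B p) ?gt_eqF// ?(ltW B_gt0)//.
  rewrite -!powRM ?powR_ge0 ?mulr_ge0 ?powR_ge0 ?lorentz_sum_ge0//.
  apply: powR_le => //; first by apply: sumr_ge0 => i _; exact: powR_ge0.
  by rewrite -mulrA; exact: sum_digits_le.
apply: le_trans (HC _ _ (fun=> M / 2 ^+ K * (B * primitive w 1)) _) _.
  move=> n; rewrite -scalerA (qnormZ nrm_quasi) modulus_of_real.
  have Mn : 0 <= moduli a n <= M by rewrite modulus_ge0; exact: moduli_le_decr0 am.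
  have /andP[r0 rM] := binary_rest_bounds K Mn.
  rewrite ger0_norm//; apply: ler_pM => //; first exact: qnorm_ge0.
  have := @signed_indicator_le [fset val n]%fset eps; rewrite cardfs1.
  rewrite /signed_indicator big_seq_fset1; apply=> j _; exact: modulus_sign.
rewrite ler_pM2l//; apply: le_trans (decr0_le_lorentz_sum _ _) => //.
have s1 := primitive_ge0 1 w_weight.
have M2 : 0 <= M / 2 ^+ K by rewrite divr_ge0// exprn_ge0.
rewrite sumr_const card_ord -[_ *+ m]mulr_natl powRM ?powR_ge0// powRK ?gt_eqF//; last first.
  by rewrite !mulr_ge0// ltW.
rewrite -/M [leLHS](_ : _ = M * primitive w 1 * (B * m%:R `^ p^-1 / 2 ^+ K)); last by ring.
by rewrite -[leRHS]mulr1 ler_wpM2l// mulr_ge0.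
Qed.

Lemma lorentz_sum_le_gauge m a (G : R) : d1_gauge p%:E w a = G%:E ->
  lorentz_sum m (first_coordinates m a) `^ p^-1 <= G.
Proof.
move=> aG; have u0 := lorentz_weight_gt0 p w_weight.
rewrite -lee_fin -aG d1_gaugeE; apply: le_trans (le_rearrangement_gauge _ m a).
rewrite (weighted_norm_finite (m := m))// => n mn.
apply: decr_eq0 mn => j mj; rewrite /moduli (@supported_first _ _ m a j mj); exact: modulus0.
Qed.

Definition block m n a : nat -> F := fun j => if (m <= j < n)%N then a j else 0.

Lemma block_supported m n a : supported n (block m n a).
Proof. by move=> j nj; rewrite /block ltnNge nj andbF. Qed.

Lemma block_sum m n a : (m <= n)%N ->
  \sum_(i < n) a i *: xx i - \sum_(i < m) a i *: xx i = \sum_(i < n) block m n a i *: xx i.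
Proof.
move=> mn; rewrite (big_ord_widen _ (fun i => a i *: xx i) mn) [X in _ - X]big_mkcond/= -sumrB.
apply: eq_bigr => i _; rewrite /block ltn_ord andbT; case: ltnP => _; last by rewrite subr0.
by rewrite subrr scale0r.
Qed.

(* Cutting the rearrangement at [m0], where the sums for the truncations of [a]
   are almost maximal, leaves little mass beyond [m0] uniformly in the
   truncation, while the first [m0] terms are small because [a] is in [c0]. *)
Lemma lorentz_sum_block_small a (G e : R) : c0 a -> 0 < e ->
  (forall m, lorentz_sum m (first_coordinates m a) <= G) ->
  exists N, forall m n, (N <= m)%N -> (m <= n)%N -> lorentz_sum n (block m n a) <= e.
Proof.
move=> ac0 e0 HG; have u0 := lorentz_weight_gt0 p w_weight.
pose V := [set lorentz_sum m (first_coordinates m a) | m in [set: nat]].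
have e2 : 0 < e / 2 by rewrite divr_gt0.
have supV : has_sup V.
  by split; [exists (lorentz_sum 0 (first_coordinates 0 a)); exists 0%N|exists G => _ [m _ <-]].
have [_ [m0 _ <-] Hm0] := sup_adherent e2 supV.
(* [d] is chosen so that [d ^ p * primitive u m0] is at most e / 2; adding 1 keeps the divisor
   positive when m0 = 0. *)
pose t := primitive u m0 + 1; have t0 : 0 < t by rewrite ltr_wpDl// primitive_ge0.
pose d := (e / 2 / t) `^ p^-1; have d0 : 0 < d by rewrite powR_gt0// !divr_gt0.
have [N1 _ HN1] := cvgr0_norm_lt _ ac0 d d0.
exists (maxn m0 N1) => m n; rewrite geq_max => /andP[m0m N1m] mn.
have m0n : (m0 <= n)%N := leq_trans m0m mn.
have split_sum (f : nat -> F) : lorentz_sum n f =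
    lorentz_sum m0 f + \sum_(m0 <= i < n) decr (moduli f) i `^ p * u i.
  by rewrite /lorentz_sum -!(big_mkord xpredT (fun i => decr (moduli f) i `^ p * u i)) -big_cat_nat.
have bfirst := bounded_moduli (@supported_first _ _ n a).
rewrite split_sum (splitr e); apply: lerD.
  apply: (@le_trans _ _ (\sum_(i < m0) d `^ p * u i)).
    apply: ler_sum => i _; apply: ler_wpM2r; first exact: ltW.
    apply: powR_le; [exact: ltW|exact: decr_ge0|].
    apply: (@decr_le _ _ _ fset0) => // [|j _]; first exact: ltW.
    rewrite /moduli /block; case: ifP => [/andP[mj _]|_]; last by rewrite modulus0 ltW.
    have := HN1 j (leq_trans N1m mj); rewrite /= ger0_norm ?modulus_ge0//; exact: ltW.
  rewrite -mulr_sumr powRVK ?gt_eqF//; last by rewrite !divr_ge0// ltW.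
  rewrite -/(primitive u m0) mulrAC ler_pdivrMr// ler_pM2l//; rewrite /t; lra.
apply: (@le_trans _ _ (\sum_(m0 <= i < n) decr (moduli (first_coordinates n a)) i `^ p * u i)).
  apply: ler_sum => i _; apply: ler_wpM2r; first exact: ltW.
  apply: powR_le; [exact: ltW|exact: decr_ge0|].
  apply: decr_mono => // j; rewrite moduli_first /moduli /block.
  by case: (j < n)%N; rewrite ?andbF ?modulus0//; case: ifP => _ //=; rewrite modulus0 modulus_ge0.
have Vn : V (lorentz_sum n (first_coordinates n a)) by exists n.
have := ub_le_sup (proj2 supV) Vn.
rewrite split_sum => Hn.
have : lorentz_sum m0 (first_coordinates m0 a) <= lorentz_sum m0 (first_coordinates n a).
  apply: ler_sum => i _; apply: ler_wpM2r; first exact: ltW.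
  apply: powR_le; [exact: ltW|exact: decr_ge0|].
  apply: decr_mono => // j; rewrite !moduli_first.
  case: ltnP => jm0; first by rewrite (leq_trans jm0 m0n).
  by case: ifP => _ //; exact: modulus_ge0.
by move: Hn Hm0; lra.
Qed.

Hypothesis nrm_complete : forall v, cauchy_sequence nrm v -> exists l, converges_to nrm v l.

Lemma lorentz_embeds_into_X : embeds_into_X nrm xx (d1_space p%:E w) (d1_gauge p%:E w).
Proof.
have [D D0 HD] := lorentz_sum_bound.
have [_ _ _ [kappa [kappa1 nrmD]]] := nrm_quasi.
have kappa0 : 0 < kappa by exact: lt_le_trans kappa1.
have u0 := lorentz_weight_gt0 p w_weight.
(* A quasi-norm need not be continuous: passing from partial sums to the limit uses the
   quasi-triangle inequality, at the price of [kappa]. *)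
exists (kappa * D) => a [ac0 aG].
have /fineK G0E : d1_gauge p%:E w a \is a fin_num.
  rewrite ge0_fin_numE// d1_gaugeE; apply: rearrangement_gauge_ge0.
  exact: weighted_norm_sequence_norm.
set G := fine _ in G0E; have {aG}G0E : d1_gauge p%:E w a = G%:E by rewrite G0E.
have HG m := lorentz_sum_le_gauge m G0E.
have G0 : 0 <= G by apply: le_trans (HG 0%N); exact: powR_ge0.
have HGp m : lorentz_sum m (first_coordinates m a) <= G `^ p.
  rewrite -[leLHS](@powRVK _ _ p) ?gt_eqF ?lorentz_sum_ge0//.
  by apply: powR_le => //; [exact: ltW|exact: powR_ge0].
pose S m := \sum_(n < m) a n *: xx n.
have S_le m : nrm (S m) <= D * G.
  have -> : S m = \sum_(n < m) first_coordinates m a n *: xx n.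
    by apply: eq_bigr => n _; rewrite /first_coordinates ltn_ord.
  by apply: le_trans (HD _ _ (@supported_first _ _ m a)) _; rewrite ler_pM2l.
have S_cauchy : cauchy_sequence nrm S.
  move=> e e0; pose e' := (e / 2 / D) `^ p.
  (* Taking the p-th root of e' and multiplying by [D] returns e / 2, strictly below e. *)
  have e'0 : 0 < e' by rewrite powR_gt0// !divr_gt0.
  have [N HN] := lorentz_sum_block_small ac0 e'0 HGp.
  have S_sub m n : (N <= m)%N -> (m <= n)%N -> nrm (S n - S m) < e.
    move=> Nm mn; rewrite block_sum//.
    apply: le_lt_trans (HD _ _ (@block_supported m n a)) _.
    apply: (@le_lt_trans _ _ (D * (e / 2 / D))); last first.
      by rewrite mulrC divfK ?gt_eqF// ltr_pdivrMr// ltr_pMr// ltr1n.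
    rewrite ler_pM2l// -[leRHS](@powRK _ _ p) ?gt_eqF//; last by rewrite !divr_ge0// ltW.
    by apply: powR_le => //; [exact: lorentz_sum_ge0|exact: HN].
  exists N => m n Nm Nn; have [mn|nm] := leqP m n.
    by rewrite -(qnormN nrm_quasi) opprB; exact: S_sub.
  exact/S_sub/ltnW.
have [g Sg] := nrm_complete S_cauchy; exists g; split=> //.
rewrite G0E -EFinM lee_fin; apply/ler_addgt0Pr => e e0.
have ek : 0 < e / kappa by rewrite divr_gt0.
have [N _ HN] := cvgr0_norm_lt _ Sg _ ek.
have := HN N (leqnn N); rewrite /= ger0_norm ?(qnorm_ge0 nrm_quasi)// => SN.
have -> : g = S N + (g - S N) by rewrite addrC subrK.
apply: le_trans (nrmD _ _) _; rewrite -mulrA -ler_pdivlMl// mulrDr mulKf ?gt_eqF//.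
by rewrite lerD// -(qnormN nrm_quasi) opprB mulrC ltW.
Qed.

End Embedding.

Theorem theorem8p14 (R : realType) (k : scalar_kind)
    (X : lmodType (scalar_field R k)) (nrm : X -> R)
    (xx : nat -> X) (xs : nat -> {scalar X}) (p : R)
    (p_gt0 : 0 < p) (p_le1 : p <= 1)
    (X_quasi_banach : quasi_banach nrm) (X_p_convex : p_convex nrm p)
    (xx_basis : is_basis nrm xx xs)
    (xx_M_bounded : M_bounded nrm xx xs)
    (xx_semi_normalized : semi_normalized nrm xx) :
  (super_democratic nrm xx -> truncation_bounded nrm xx xs ->
   forall w : nat -> R, weight w ->
   equivalent (primitive w) (phi_u nrm xx) ->
   [/\ lorentz_sandwich nrm xx xs p w,
       quasi_banach_function_space (@d1_gauge R k p%:E w) /\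
         symmetric_gauge (@d1_gauge R k p%:E w),
       quasi_banach_function_space (@d1_gauge R k +oo%E w) /\
         symmetric_gauge (@d1_gauge R k +oo%E w) &
       equivalent (fundamental (@d1_gauge R k p%:E w))
                  (fundamental (@d1_gauge R k +oo%E w))])
  /\
  (forall (q : R) (w : nat -> R), 0 < q -> weight w ->
   lorentz_sandwich nrm xx xs q w ->
   equivalent (phi_l nrm xx) (primitive w) /\
   equivalent (primitive w) (phi_u nrm xx)).
Proof.
have [nrm_quasi nrm_complete] := X_quasi_banach.
have [_ _ biorthogonal] := xx_basis.
split; last by move=> q w q0 w0; exact: lorentz_sandwich_equivalent.
move=> democratic truncation w w0 sphi.
have p01 : 0 < p <= 1 by rewrite p_gt0.
have wd : doubling w := doubling_of_phi_u nrm_quasi democratic w0 sphi.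
split; [|exact: d1_quasi_banach|exact: d1y_quasi_banach|exact: equivalent_fundamental_d1].
split; last exact: truncation_bounded_X_embeds_into sphi truncation.
have [m|m|B B0 HB] := equivalent_pos sphi; first exact: primitive_ge0.
  exact: phi_u_ge0.
apply: (@lorentz_embeds_into_X R k X nrm nrm_quasi p p01 X_p_convex xx w B w0 B0) => //.
(* The empty set is treated apart because [equivalent] gives no information at cardinality 0. *)
move=> A eps epsA; have [A0|A0] := posnP #|` A|%fset.
  rewrite A0 (cardfs0_eq A0) primitive0 mulr0 /signed_indicator big_seq_fset0.
  by rewrite (qnorm0 nrm_quasi).
have [_ phis] := HB _ A0; apply: le_trans phis.
exact: le_phi_u.
Qed.
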